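(* Let $K$ be any infinite field and let $k\ge 3$. For all $n_1,\dots,n_k\in\mathbb{N}$ the generic subrank of tensors in $K^{n_1}\otimes\cdots\otimes K^{n_k}$ is $$Q(n_1,\dots,n_k)=\min\left\{n_1,\dots,n_k,\left\lfloor(n_1+\cdots+n_k-(k-1))^{\frac{1}{k-1}}\right\rfloor\right\}.$$ In particular, for every $n\in\mathbb{N}$, $Q(\underbrace{n,\dots,n}_{k})=\left\lfloor(kn-k+1)^{\frac{1}{k-1}}\right\rfloor$.
   Context: $\mathbb{N}$ denotes the positive integers. Write $K^{n_1,\dots,n_k}:=K^{n_1}\otimes\cdots\otimes K^{n_k}$. For tensors $S\in K^{m_1,\dots,m_k}$ and $T\in K^{n_1,\dots,n_k}$ write $S\le T$ if there are linear maps $A_i:K^{n_i}\to K^{m_i}$ with $(A_1\otimes\cdots\otimes A_k)T=S$. For $s\ge 0$ let $I_s=\sum_{j=1}^s e_j\otimes\cdots\otimes e_j$ ($k$ factors, $e_1,\dots,e_s$ the standard basis of $K^s$) be the unit tensor of size $s$. The subrank $Q(T)$ of $T\in K^{n_1,\dots,n_k}$ is the largest integer $s\ge 0$ with $I_s\le T$. Let $\mathcal{C}_r^{(n_1,\dots,n_k)}=\{T\in K^{n_1,\dots,n_k} : Q(T)\ge r\}$. The generic subrank $Q(n_1,\dots,n_k)$ is the largest $r$ such that $\mathcal{C}_r^{(n_1,\dots,n_k)}$ is Zariski-dense in $K^{n_1,\dots,n_k}$. *)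

(* Defs.v *)
From HB Require Import structures.
From mathcomp Require Import all_boot all_order all_algebra all_field.
From mathcomp Require Import mpoly.

Set Implicit Arguments.
Unset Strict Implicit.
Unset Printing Implicit Defensive.

Import Order.TTheory GRing.Theory Num.Theory.
Local Open Scope ring_scope.

Definition infinite_type (T : eqType) : Prop :=
  forall s : seq T, exists x : T, x \notin s.

Definition is_largest (P : nat -> Prop) (r : nat) : Prop :=
  P r /\ forall s : nat, P s -> (s <= r)%N.

Notation tindex n := {dffun forall l, 'I_(n l)}.

(* K^{n_1} (x) ... (x) K^{n_k}, in coordinates with respect to the basis
   e_{j_1} (x) ... (x) e_{j_k}; factors are indexed by l : 'I_k. *)
Definition tensor (K : fieldType) (k : nat) (n : 'I_k -> nat) : Type :=
  {ffun tindex n -> K}.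

Definition pure_tensor (K : fieldType) (k : nat) (n : 'I_k -> nat)
    (v : forall l, 'cV[K]_(n l)) : tensor K n :=
  [ffun j : tindex n => \prod_(l < k) v l (j l) 0].

(* (A_1 (x) ... (x) A_k) T, where the matrix A_l acts on column vectors. *)
Definition tensor_map (K : fieldType) (k : nat) (m n : 'I_k -> nat)
    (A : forall l, 'M[K]_(m l, n l)) (T : tensor K n) : tensor K m :=
  [ffun j : tindex m =>
     \sum_(i : tindex n) (\prod_(l < k) A l (j l) (i l)) * T i].

Definition tensor_le (K : fieldType) (k : nat) (m n : 'I_k -> nat)
    (S : tensor K m) (T : tensor K n) : Prop :=
  exists A : forall l, 'M[K]_(m l, n l), tensor_map A T = S.

Definition unit_tensor (K : fieldType) (k s : nat) :
    tensor K (fun _ : 'I_k => s) :=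
  [ffun j => \sum_(a < s) pure_tensor (fun _ : 'I_k => delta_mx a 0) j].

Definition is_subrank (K : fieldType) (k : nat) (n : 'I_k -> nat)
    (T : tensor K n) (q : nat) : Prop :=
  is_largest (fun s => tensor_le (unit_tensor K k s) T) q.

Definition subrank_ge (K : fieldType) (k : nat) (n : 'I_k -> nat) (r : nat)
    (T : tensor K n) : Prop :=
  exists q : nat, is_subrank T q /\ (r <= q)%N.

(* One variable for each coordinate of a tensor of shape n. *)
Notation tpoly K n := {mpoly K[#|{: tindex n}|]}.

Definition tpoly_eval (K : fieldType) (k : nat) (n : 'I_k -> nat)
    (p : tpoly K n) (T : tensor K n) : K :=
  p.@[fun i => T (enum_val i)].

Definition zariski_closed (K : fieldType) (k : nat) (n : 'I_k -> nat)
    (Z : tensor K n -> Prop) : Prop :=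
  exists S : tpoly K n -> Prop,
    forall T, Z T <-> (forall p, S p -> tpoly_eval p T = 0).

Definition zariski_dense (K : fieldType) (k : nat) (n : 'I_k -> nat)
    (C : tensor K n -> Prop) : Prop :=
  forall Z : tensor K n -> Prop,
    zariski_closed Z -> (forall T, C T -> Z T) -> forall T, Z T.

Definition is_generic_subrank (K : fieldType) (k : nat) (n : 'I_k -> nat)
    (q : nat) : Prop :=
  is_largest (fun r => zariski_dense (@subrank_ge K k n r)) q.

(* floor (x ^ (1 / d)); on nonnegative reals, d.-root of algC is the usual
   nonnegative real d-th root. *)
Definition floor_root (d : nat) (x : algC) : nat := Num.truncn (d.-root x).

(* Main.v *)
Require Import Defs.
From mathcomp Require Import all_boot all_order all_algebra all_field.
From mathcomp Require Import mpoly zify ring.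
From Stdlib Require Import Classical.

(** Let [N] be the product of the [n_l].  The subrank of [T] is at least [r] if and
    only if [I_r <= T] ([subrank_geE]), and the set of these [T] is dense exactly
    when [r <= n_l] for all [l] and [r^(k-1) + (k-1) <= sum_l n_l]
    ([dense_subrank_geP]); the theorem only solves this condition for [r].

    Upper bound ([unit_le_hypersurface]).  If [(A_1 (x) ... (x) A_k) T = I_r],
    each [A_l] has an invertible maximal minor; after dividing by it, [T] is
    determined by the other columns of the [A_l], by the entries of [T] off an
    [r x ... x r] block, and by a tensor [sum_a b_{1,a} (x) ... (x) b_{k,a}],
    where for each [a] all but one of the [b_{l,a}] can be normalised to have an
    entry 1.
    So the tensors in question are covered by finitely many polynomial images
    of an affine space of dimension [N + r (sum_l n_l - (k-1) - r^(k-1))].  When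
    this is below [N], counting monomials gives a nonzero polynomial vanishing
    on each image ([mpoly_dependent]), hence one vanishing on their union.

    Lower bound ([unit_le_dense]).  The tensors [g T] with [g] invertible and
    with [T] having [I_r] in its corner [[r]^k] satisfy [I_r <= g T].  Along the
    curves [t |-> (1 + t E) (T + t U)], with [U] zero on the corner, the velocity
    at [t = 0] is arbitrary as soon as a linear-algebraic condition on [T] holds
    ([corner_spanning]): the products of the [r] basis vectors in direction [l]
    with the slices of [T] in direction [l] span the corner.  In every
    characteristic, this makes the lowest homogeneous part of any polynomial
    vanishing on those tensors vanish everywhere ([vanishing_of_curves]).

    It remains to find such a [T].  The diagonal of the corner already produces
    all positions with [k-1] equal coordinates; each further slice in direction
    [l], of which there are [n_l - r], must produce [r] new positions without
    waste when [sum_l n_l] is minimal.  Identify [[r]] with [Z/r]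
    and group the positions into orbits under diagonal translation, called
    cells.  A family of [g] slices in direction [l], supported on the orbit of one
    line and with the entries of a Cauchy matrix, produces [g] cells of that
    orbit of lines provided that its other cells have been produced before
    ([vanishing_of_schedule]).  So one needs to order the cells, and to give each
    a direction, such that every cell comes after the cells of its line having
    another direction, and direction [l] is given to at most [n_l - r] cells.  Such
    a schedule exists for all quotas of sufficient sum ([schedulable_of_quota]). *)

Set Implicit Arguments.
Unset Strict Implicit.
Unset Printing Implicit Defensive.
Import Order.TTheory GRing.Theory Num.Theory.
Local Open Scope ring_scope.

(** * Polynomials over an infinite field *)

Section InfiniteField.
Variables (K : fieldType) (infK : infinite_type K).

Lemma infinite_uniq_seq m : exists s : seq K, uniq s /\ size s = m.
Proof.
elim: m => [|m [s [us ss]]]; first by exists [::].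
by have [x xs] := infK s; exists (x :: s); rewrite /= xs ss.
Qed.

Lemma infinite_inj (T : finType) : exists f : T -> K, injective f.
Proof.
have [s [us ss]] := infinite_uniq_seq #|T|.
exists (fun x => s`_(enum_rank x)) => x y /eqP.
by rewrite nth_uniq ?ss // => /eqP/val_inj/enum_rank_inj.
Qed.

Lemma poly_nonroot (q : {poly K}) : q != 0 -> exists t, q.[t] != 0.
Proof.
move=> q0; have [s [us ss]] := infinite_uniq_seq (size q).
have [/(max_poly_roots q0)/(_ us)|] := boolP (all (root q) s).
  by rewrite ss ltnn.
by case/allPn=> t _; exists t.
Qed.

(** The factor [d] excludes the finitely many parameters at which a
    construction degenerates. *)
Lemma poly_eq0_cofinite (q : {poly K}) (d : {poly K}) :
  d != 0 -> (forall t, d.[t] != 0 -> q.[t] = 0) -> q = 0.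
Proof.
move=> d0 qd; apply/eqP; apply: contraT => q0.
have [t] : exists t, (d * q).[t] != 0 by apply: poly_nonroot; rewrite mulf_neq0.
rewrite hornerM mulf_eq0 negb_or => /andP[/qd ->]; by rewrite eqxx.
Qed.

End InfiniteField.

Lemma base_expansion_inj d n (e f : 'I_n -> nat) :
    (forall i, e i < d)%N -> (forall i, f i < d)%N ->
  (\sum_i e i * d ^ i = \sum_i f i * d ^ i)%N -> e =1 f.
Proof.
elim: n e f => [|n IH] e f led ltd; first by move=> _ [].
have shift (g : 'I_n.+1 -> nat) : (\sum_i g i * d ^ i =
    g ord0 + (\sum_(i < n) g (lift ord0 i) * d ^ i) * d)%N.
  rewrite big_ord_recl /= expn0 muln1 big_distrl /=; congr addn.
  by apply: eq_bigr => i _; rewrite /bump /= add1n expnSr mulnA.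
rewrite !shift => E.
have E0 : e ord0 = f ord0.
  by have := congr1 (modn^~ d) E; rewrite (addnC (e _)) (addnC (f _)) !modnMDl !modn_small.
have d0 : (0 < d)%N by apply: leq_ltn_trans (led ord0).
have /IH E1 : (\sum_(i < n) e (lift ord0 i) * d ^ i =
               \sum_(i < n) f (lift ord0 i) * d ^ i)%N.
  by move: E; rewrite E0 => /addnI/eqP; rewrite eqn_pmul2r // => /eqP.
move=> i; case: (unliftP ord0 i) => [j|] -> //; exact: E1.
Qed.

(** Kronecker substitution [x_i = t^(d^i)] with [d] above all exponents keeps
    distinct monomials distinct, so it reduces the claim to one variable. *)
Lemma mpoly_nonzero_value (K : fieldType) (infK : infinite_type K) n
    (p : {mpoly K[n]}) : p != 0 -> exists v, p.@[v] != 0.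
Proof.
move=> p0; pose d := msize p.
(* The exponent of the monomial m after the substitution. *)
pose w (m : 'X_{1..n}) := (\sum_i m i * d ^ i)%N.
have w_inj : {in msupp p &, injective w}.
  move=> m m' mp m'p E; apply/mnmP; apply: (@base_expansion_inj d) => // i.
    by apply: leq_ltn_trans (msize_mdeg_lt mp); rewrite mdegE (bigD1 i) //= leq_addr.
  by apply: leq_ltn_trans (msize_mdeg_lt m'p); rewrite mdegE (bigD1 i) //= leq_addr.
pose q : {poly K} := \sum_(m <- msupp p) p@_m *: 'X^(w m).
have : q != 0.
  have mp := mlead_supp p0.
  apply: contraTneq mp => /(congr1 (fun q : {poly K} => q`_(w (mlead p)))).
  rewrite coef0 coef_sum => E; apply/negP => mp; move: E.
  rewrite (bigD1_seq (mlead p)) ?msupp_uniq //= coefZ coefXn eqxx mulr1.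
  rewrite big_seq_cond big1 ?addr0 => [/eqP|m /andP[mp' ne]].
    by rewrite mleadc_eq0 (negPf p0).
  rewrite coefZ coefXn; case: eqP => [/w_inj|]; rewrite ?mulr0 // => E.
  by rewrite E ?eqxx // in ne.
case/(poly_nonroot infK) => t qt; exists (fun i => t ^+ (d ^ i)).
suff <- : q.[t] = p.@[fun i => t ^+ (d ^ i)] by [].
rewrite mevalE horner_sum; apply: eq_bigr => m _.
rewrite hornerZ hornerXn; congr (_ * _).
rewrite /w expr_sum; apply: eq_bigr => i _; by rewrite -exprM mulnC.
Qed.

Lemma exp_outgrows (M N E : nat) : (M < N)%N ->
  exists d, (0 < d)%N /\ ((E * d) ^ M < d ^ N)%N.
Proof.
move=> MN; exists (E ^ M).+1; split=> //.
apply: (@leq_trans ((E ^ M).+1 ^ M.+1)); last by rewrite leq_pexp2l.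
by rewrite expnMn expnS ltn_mul2r expn_gt0 /=.
Qed.

Lemma msize_mul_le (R : idomainType) n (p q : {mpoly R[n]}) :
  (msize (p * q) <= (msize p + msize q).-1)%N.
Proof.
have [->|p0] := eqVneq p 0; first by rewrite mul0r msize0.
have [->|q0] := eqVneq q 0; first by rewrite mulr0 msize0.
by rewrite msizeM.
Qed.

Lemma msize_exp_bound (R : idomainType) n (p : {mpoly R[n]}) D e :
  (msize p <= D.+1 -> msize (p ^+ e) <= (e * D).+1)%N.
Proof.
move=> pD; elim: e => [|e IH]; first by rewrite expr0 msize1.
rewrite exprS; apply: leq_trans (msize_mul_le _ _) _.
rewrite mulSn; move: pD IH; set a := msize _; set b := msize _; lia.
Qed.

Lemma msize_prod_bound (R : idomainType) n (I : finType) (F : I -> {mpoly R[n]}) B :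
  (forall i, msize (F i) <= B.+1)%N -> (msize (\prod_i F i)%R <= (#|I| * B).+1)%N.
Proof.
move=> FB; rewrite cardE -big_enum /=.
elim: (enum I) => [|i s IH]; first by rewrite big_nil msize1.
rewrite big_cons; apply: leq_trans (msize_mul_le _ _) _.
by move: (FB i) IH; rewrite /= mulSn; set a := msize _; set b := msize _; lia.
Qed.

(** The [d^N] monomials in the [F j] with exponents below [d] have degree [O(d)], so
    they lie in a space of dimension [O(d^M)]; for large [d] they satisfy a linear
    relation, whose coefficients are those of [p]. *)
Lemma mpoly_dependent (K : fieldType) M N (F : 'I_N -> {mpoly K[M]}) :
  (M < N)%N ->
  exists2 p : {mpoly K[N]}, p != 0 & forall v, p.@[fun j => (F j).@[v]] = 0.
Proof.
move=> MN; pose D := (\max_j msize (F j))%N.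
have FD j : (msize (F j) <= D.+1)%N by apply/leqW; apply: leq_bigmax.
have [d [d0 Ed]] := exp_outgrows (N * D).+1 MN.
pose B := ((N * D).+1 * d)%N.
pose G (e : {ffun 'I_N -> 'I_d}) := \prod_j F j ^+ e j.
have GB e : (msize (G e) <= B)%N.
  apply: leq_trans (_ : (#|'I_N| * (d.-1 * D)).+1 <= _)%N.
    apply: msize_prod_bound => j; apply: leq_trans (msize_exp_bound _ (FD j)) _.
    by rewrite ltnS leq_mul2r; have := ltn_ord (e j); lia.
  rewrite card_ord /B mulSn; case: (d) d0 => // d' _ /=.
  by rewrite (mulnC d') mulnA mulnS; lia.
pose mon (u : {ffun 'I_M -> 'I_B}) := [multinom (u i : nat) | i < M].
pose A := \matrix_(i < #|{: {ffun 'I_N -> 'I_d}}|, j < #|{: {ffun 'I_M -> 'I_B}}|)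
  (G (enum_val i))@_(mon (enum_val j)).
have [c c0 cA] : exists2 c : 'rV_#|{: {ffun 'I_N -> 'I_d}}|, c != 0 & c *m A = 0.
  have : kermx A != 0.
    rewrite kermx_eq0 -row_leq_rank -ltnNge; apply: leq_ltn_trans (rank_leq_col A) _.
    by rewrite !card_ffun !card_ord.
  by case/rowV0Pn => c /sub_kermxP cA c0; exists c.
pose cf e := c 0 (enum_rank e).
pose mo (e : {ffun 'I_N -> 'I_d}) := [multinom (e i : nat) | i < N].
have mo_inj : injective mo.
  move=> e e' /mnmP E; apply/ffunP => i; apply: val_inj.
  by have := E i; rewrite !mnmE.
exists (\sum_e cf e *: 'X_[mo e]).
  apply: contra c0 => /eqP p0; apply/eqP/rowP => i; rewrite mxE.
  have := congr1 (mcoeff (mo (enum_val i))) p0; rewrite mcoeff0 => <-.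
  rewrite (raddf_sum (mcoeff _)) /= (bigD1 (enum_val i)) //= big1 => [|e ne].
    by rewrite addr0 mcoeffZ mcoeffX eqxx mulr1 /cf enum_valK.
  by rewrite mcoeffZ mcoeffX (inj_eq mo_inj) (negPf ne) mulr0.
have comb0 : \sum_e cf e *: G e = 0.
  apply/mpolyP => m; rewrite mcoeff0 (raddf_sum (mcoeff _)) /=.
  have [mB|Bm] := ltnP (mdeg m) B; last first.
    apply: big1 => e _; rewrite mcoeffZ; apply/eqP; rewrite mulf_eq0; apply/orP; right.
    by rewrite mcoeff_eq0; apply: msize_mdeg_ge; apply: leq_trans Bm.
  have miB i : (m i < B)%N.
    by apply: leq_ltn_trans mB; rewrite mdegE (bigD1 i) //= leq_addr.
  pose u := [ffun i => Ordinal (miB i)].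
  have mu : m = mon u by apply/mnmP => i; rewrite mnmE ffunE.
  have cu := congr1 (fun w : 'rV_ _ => w 0 (enum_rank u)) cA.
  rewrite !mxE in cu; rewrite -[RHS]cu.
  rewrite (reindex_onto (@enum_val _ _) (@enum_rank _)) /=; last by move=> e _; apply: enum_rankK.
  apply: eq_big => [i|i _]; first by rewrite enum_valK eqxx.
  by rewrite mcoeffZ /cf enum_valK mxE enum_rankK mu.
move=> v; have c0v := congr1 (meval v) comb0.
rewrite meval0 in c0v; rewrite -[RHS]c0v.
rewrite !(raddf_sum (meval _)) /=; apply: eq_bigr => e _.
rewrite !mevalZ mevalX (rmorph_prod (meval v)) /=; congr (_ * _).
by apply: eq_bigr => j _; rewrite mnmE rmorphXn.
Qed.

(** * Polynomials vanishing along curves *)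

Lemma poly_split_X (R : nzRingType) (q : {poly R}) :
  exists V : {poly R}, q = V * 'X + (q`_0)%:P /\ V.[0] = q`_1.
Proof.
elim/poly_ind: q => [|V c _].
  by exists 0; rewrite !coef0 mul0r horner0 polyC0 addr0.
by exists V; rewrite !coefD !coefMX !coefC /= add0r addr0 horner_coef0.
Qed.

(** A form of the implication from a surjective differential to a dense image
    that is valid in every characteristic: expand [p] around [c]; along a
    curve [c + t Y + O(t^2)] the lowest homogeneous part of [p], evaluated at [Y],
    is the lowest coefficient of [p] as a polynomial in [t], hence zero.  The
    polynomial [d] is nonzero at the parameters where the curve lies in the set of interest. *)
Lemma vanishing_of_curves (K : fieldType) (infK : infinite_type K) N
    (p : {mpoly K[N]}) (c : 'I_N -> K) :
    (forall Y : 'I_N -> K, exists T : 'I_N -> {poly K}, exists d : {poly K},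
      [/\ d != 0, forall i, (T i)`_0 = c i, forall i, (T i)`_1 = Y i
        & forall t, d.[t] != 0 -> p.@[fun i => (T i).[t]] = 0]) ->
  forall v, p.@[v] = 0.
Proof.
move=> curves; pose p' := p \mPo [tuple 'X_i + (c i)%:MP | i < N].
have p'E v : p'.@[v] = p.@[fun i => v i + c i].
  rewrite comp_mpoly_meval; apply: meval_eq => i.
  by rewrite tnth_mktuple mevalD mevalXU mevalC.
have [p'0|p'0] := eqVneq p' 0.
  move=> v; have := p'E (fun i => v i - c i); rewrite p'0 meval0 => ->.
  by apply: meval_eq => i; rewrite subrK.
have exe : exists e, has (fun m => mdeg m == e) (msupp p').
  by exists (mdeg (mlead p')); apply/hasP; exists (mlead p'); rewrite ?mlead_supp.
case: (ex_minnP exe) => e /hasP[m0 m0p /eqP m0e] emin.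
have edeg m : m \in msupp p' -> (e <= mdeg m)%N.
  by move=> mp; apply: emin; apply/hasP; exists m.
pose h := \sum_(m <- msupp p' | mdeg m == e) p'@_m *: 'X_[m].
have h0 : h != 0.
  apply: contraTneq m0p => /(congr1 (mcoeff m0)); rewrite mcoeff0 (raddf_sum (mcoeff _)) /=.
  move=> E; apply/negP => m0p; move: E; rewrite -big_filter (bigD1_seq m0) /=.
  - rewrite mcoeffZ mcoeffX eqxx mulr1 big1 ?addr0 => [/eqP|m ne].
      by rewrite mcoeff_eq0 m0p.
    by rewrite mcoeffZ mcoeffX (negPf ne) mulr0.
  - by rewrite mem_filter m0e eqxx.
  - by rewrite filter_uniq ?msupp_uniq.
have [Y hY] := mpoly_nonzero_value infK h0.
have [T [d [d0 T0 T1 Td]]] := curves Y.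
have /fin_all_exists2[V TV V0] : forall i,
    exists2 V : {poly K}, T i = V * 'X + (c i)%:P & V.[0] = Y i.
  by move=> i; have [V] := poly_split_X (T i); rewrite T0 T1 => -[]; exists V.
pose Q : {poly K} := \sum_(m <- msupp p') p'@_m *: ('X^(mdeg m - e) * \prod_i V i ^+ m i).
have XQ : 'X^e * Q = 0.
  apply: (poly_eq0_cofinite infK d0) => t /Td pt.
  rewrite -[RHS]pt; have -> : p.@[fun i => (T i).[t]] = p'.@[fun i => t * (V i).[t]].
    rewrite p'E; apply: meval_eq => i.
    by rewrite TV hornerD hornerMX hornerC mulrC.
  rewrite mevalE hornerM hornerXn horner_sum big_distrr /= big_seq [RHS]big_seq.
  apply: eq_bigr => m /edeg me; rewrite hornerZ hornerM hornerXn horner_prod.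
  under [in RHS]eq_bigr do rewrite exprMn.
  rewrite big_split /= prodrXr -mdegE mulrCA; congr (_ * _).
  rewrite mulrA -exprD subnKC //; congr (_ * _).
  by apply: eq_bigr => i _; rewrite horner_exp.
move/eqP: XQ; rewrite mulf_eq0 expf_eq0 polyX_eq0 andbF /= => /eqP Q0.
case/eqP: hY; rewrite -(horner0 (0 : K)) -Q0 horner_sum /h (raddf_sum (meval _)) /=.
rewrite [RHS](bigID (fun m => mdeg m == e)) /= [X in _ = _ + X]big_seq_cond.
rewrite [X in _ = _ + X]big1 ?addr0 => [|m /andP[/edeg me mne]].
  apply: eq_bigr => m /eqP ->; rewrite mevalZ mevalX hornerZ subnn expr0 mul1r horner_prod.
  by congr (_ * _); apply: eq_bigr => i _; rewrite horner_exp V0.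
rewrite hornerZ hornerM hornerXn expr0n subn_eq0 leqNgt ltn_neqAle eq_sym mne me.
by rewrite mul0r mulr0.
Qed.

(** * Scheduling cells along lines *)

Section Schedules.
Variables (G : finZmodType) (k : nat) (o : 'I_k).
Local Notation X := {ffun 'I_k -> G}.

(** A line in direction [l], together with all its diagonal translates.  On points
    normalised by [x o = 0], direction [o] becomes the skew
    direction [(1, ..., 1)], and the others are the coordinate directions. *)
Definition same_line (l : 'I_k) (x y : X) :=
  [exists s, forall i, (i != l) ==> (y i == x i + s)].

Lemma same_lineP l (x y : X) :
  reflect (exists s, forall i, i != l -> y i = x i + s) (same_line l x y).
Proof.
apply: (iffP existsP) => -[s xy]; exists s.
  by move=> i il; move/forallP/(_ i): xy; rewrite il => /eqP.
by apply/forallP => i; apply/implyP => /xy ->.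
Qed.

Lemma same_line_refl l : reflexive (same_line l).
Proof. by move=> x; apply/same_lineP; exists 0 => i _; rewrite addr0. Qed.

Lemma same_line_sym l x y : same_line l x y = same_line l y x.
Proof.
move: x y; suff sym: forall x y, same_line l x y -> same_line l y x.
  by move=> x y; apply/idP/idP; apply: sym.
move=> x y /same_lineP[s xy]; apply/same_lineP; exists (- s) => i /xy ->.
by rewrite addrK.
Qed.

Lemma same_line_trans l : transitive (same_line l).
Proof.
move=> y x z /same_lineP[s xy] /same_lineP[t yz]; apply/same_lineP.
by exists (s + t) => i il; rewrite yz // xy // addrA.
Qed.

(** Cells are to be produced one after the other; a cell labelled [l] is produced
    by its line in direction [l], at a time when all cells of that line with
    other labels are already available. *)
Definition schedulable (W : {set X}) (Q : 'I_k -> nat) :=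
  exists (lab : X -> 'I_k) (time : X -> nat),
    (forall l, #|[set x in W | lab x == l]| <= Q l)%N /\
    (forall x y, x \in W -> y \in W -> same_line (lab x) x y ->
       lab y != lab x -> (time y < time x)%N).

Lemma schedulable_line (W : {set X}) l x Q :
  (#|[set y in W | same_line l x y]| <= Q l)%N ->
  schedulable [set y in W | same_line l x y] Q.
Proof.
move=> WQ; exists (fun=> l), (fun=> 0%N); split=> [l'|y z _ _ _]; last by rewrite eqxx.
have [<-|ne] := eqVneq l l'.
  by apply: leq_trans WQ; apply: subset_leq_card; apply/subsetP => y; rewrite inE => /andP[].
by rewrite (_ : [set _ in _ | _] = set0) ?cards0 //; apply/setP => y; rewrite !inE andbF.
Qed.

(** [W1] is produced first.  The closure hypothesis says that lines used for
    [W1] do not meet the rest, so cells of [W1] never wait for it. *)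
Lemma schedulable_split (W W1 : {set X}) (Q Q1 : 'I_k -> nat) :
    (forall l, Q1 l <= Q l)%N ->
    (forall l x y, (0 < Q1 l)%N -> x \in W1 -> y \in W -> same_line l x y -> y \in W1) ->
    schedulable W1 Q1 -> schedulable (W :\: W1) (fun l => Q l - Q1 l)%N ->
  schedulable W Q.
Proof.
move=> leQ closedW [lab1 [time1 [card1 time1P]]] [lab2 [time2 [card2 time2P]]].
pose lab x := if x \in W1 then lab1 x else lab2 x.
pose time x := (if x \in W1 then time1 x else (\max_(y in W1) time1 y).+1 + time2 x)%N.
exists lab, time; split=> [l|x y xW yW].
  rewrite -(cardsID W1 [set x in W | lab x == l]) -(subnKC (leQ l)); apply: leq_add.
    apply: leq_trans (card1 l); apply: subset_leq_card; apply/subsetP => x.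
    by rewrite !inE /lab => /andP[/andP[_ xl] xW1]; rewrite xW1 in xl *.
  apply: leq_trans (card2 l); apply: subset_leq_card; apply/subsetP => x.
  by rewrite !inE /lab => /andP[/negPf-> /andP[-> ->]].
rewrite /lab /time; case: ifPn => xW1; case: ifPn => yW1.
- exact: time1P.
- move=> xy _; case/negP: yW1; apply: (closedW _ _ _ _ xW1 yW xy).
  apply: leq_trans (card1 _); apply/card_gt0P; exists x; by rewrite inE xW1 eqxx.
- by move=> _ _; rewrite addSn ltnS; apply: leq_trans (leq_addr _ _); apply: leq_bigmax_cond.
- by move=> xy ne; rewrite ltn_add2l; apply: time2P => //; rewrite !inE ?xW1 ?yW1.
Qed.

Lemma split_quota (D : {set 'I_k}) (Q : 'I_k -> nat) m :
  (m <= \sum_(l in D) Q l)%N ->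
  exists Q1 : 'I_k -> nat, [/\ forall l, (Q1 l <= Q l)%N, forall l, l \notin D -> Q1 l = 0%N
    & (\sum_l Q1 l = m)%N].
Proof.
elim: m => [|m IH] mQ.
  by exists (fun=> 0%N); split=> //; rewrite big1.
have [Q1 [leQ out sumQ]] := IH (ltnW mQ).
have [l lD lQ] : exists2 l, l \in D & (Q1 l < Q l)%N.
  apply/exists_inP; apply: contraTT mQ => /exists_inPn full; rewrite -leqNgt -sumQ.
  rewrite [leqRHS](bigID (mem D)) /= -[leqLHS]addn0; apply: leq_add => //.
  by apply: leq_sum => l /full; rewrite -leqNgt.
exists (fun l' => Q1 l' + (l' == l))%N; split=> [l'|l' l'D|].
- by have [->|_] := eqVneq l' l; rewrite ?addn1 ?addn0.
- by rewrite out //; case: eqP l'D => // ->; rewrite lD.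
- rewrite big_split /= sumQ (bigD1 l) //= eqxx big1 ?addn0 ?addn1 // => l' /negPf->//.
Qed.

Hypothesis k_ge3 : (3 <= k)%N.

Lemma third_direction (i j : 'I_k) : exists h, h != i /\ h != j.
Proof.
have : (0 < #|~: [set i; j]|)%N.
  by rewrite cardsCs setCK card_ord cards2; lia.
by case/card_gt0P => h; rewrite !inE negb_or => /andP[]; exists h.
Qed.

(** Induction on the set [D] of coordinates in which [W] may vary, then on [W].
    Choose a cell [x0] of [W] and [t] in [D].  If the line of [x0] in direction [o] or
    [t] fits in the quota of its direction, produce that line first.  Otherwise
    produce first the layer of [x0], where coordinate [t] is constant, with the
    directions other than [o] and [t]: both lines meet the layer only at [x0] and
    meet each other only there, so outside the layer there remain at least
    [Q o + Q t] cells, and the other quotas suffice for the layer. *)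
Lemma schedulable_of_quota (D : {set 'I_k}) (W : {set X}) (Q : 'I_k -> nat) :
    o \notin D ->
    (forall x y i, x \in W -> y \in W -> i \notin D -> x i = y i) ->
    (forall l, l \notin o |: D -> Q l = 0%N) ->
    (#|W| <= \sum_l Q l)%N ->
  schedulable W Q.
Proof.
have [nD] := ubnP #|D|; elim: nD D W Q => // nD IHD D W Q /ltnSE Dn oD.
have [nW] := ubnP #|W|; elim: nW W Q => // nW IHW W Q /ltnSE Wn constW suppQ sumQ.
have [->|/set0Pn[x0 x0W]] := eqVneq W set0.
  exists (fun=> o), (fun=> 0%N); split=> [l|x y]; last by rewrite inE.
  by rewrite (_ : [set _ in _ | _] = set0) ?cards0 //; apply/setP => x; rewrite !inE.
pose L l := [set y in W | same_line l x0 y].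
have x0L l : x0 \in L l by rewrite inE x0W same_line_refl.
have play l : (#|L l| <= Q l)%N -> schedulable W Q.
  move=> LQ; pose Q1 l' := if l' == l then #|L l| else 0%N.
  have sL : L l \subset W by apply/subsetP => x; rewrite inE => /andP[].
  apply: (@schedulable_split W (L l) Q Q1) => //.
  - by move=> l'; rewrite /Q1; case: eqP => // ->.
  - move=> l' x y; rewrite /Q1; case: eqP => // -> _; rewrite !inE => /andP[_ x0x] -> xy.
    exact: same_line_trans x0x xy.
  - by apply: schedulable_line; rewrite /Q1 eqxx.
  - apply: IHW.
    + apply: leq_trans Wn; apply: proper_card.
      by apply/properP; split; [apply: subsetDl | exists x0; rewrite // !inE x0W same_line_refl].
    + by move=> x y i /setDP[xW _] /setDP[yW _]; apply: constW.
    + by move=> l' /suppQ ->; rewrite sub0n.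
    + rewrite cardsD (setIidPr sL) leq_subLR.
      have -> : #|L l| = (\sum_l' Q1 l')%N by rewrite /Q1 -big_mkcond /= big_pred1_eq.
      rewrite -big_split /=; apply: leq_trans sumQ _; apply: leq_sum => l' _; lia.
have [Qo|Qo] := leqP #|L o| (Q o); first exact: play Qo.
have [D0|/set0Pn[t tD]] := eqVneq D set0.
  move: sumQ; rewrite (bigD1 o) //= big1 ?addn0.
    move=> WQo; have sL : L o \subset W by apply/subsetP => x; rewrite inE => /andP[].
    by have := leq_trans (leq_ltn_trans WQo Qo) (subset_leq_card sL); rewrite ltnn.
  by move=> l lo; apply: suppQ; rewrite D0 !inE (negPf lo).
have [Qt|Qt] := leqP #|L t| (Q t); first exact: play Qt.
have to : t != o by apply: contraNneq oD => <-.
pose Z := [set y in W | y t == x0 t].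
have sZ : Z \subset W by apply/subsetP => x; rewrite inE => /andP[].
have LoZ x : x \in L o -> x \in Z -> x = x0.
  rewrite !inE => /andP[xW /same_lineP[s xs]] /andP[_ /eqP xt].
  have s0 : s = 0 by apply: (addrI (x0 t)); rewrite -xs // xt addr0.
  apply/ffunP => i; have [->|io] := eqVneq i o; first exact: constW.
  by rewrite xs // s0 addr0.
have LtZ x : x \in L t -> x \in Z -> x = x0.
  rewrite !inE => /andP[xW /same_lineP[s xs]] /andP[_ /eqP xt].
  have s0 : s = 0.
    by apply: (addrI (x0 o)); rewrite -xs 1?eq_sym // addr0; apply: constW.
  apply/ffunP => i; have [->//|it] := eqVneq i t.
  by rewrite xs // s0 addr0.
have Lot x : x \in L o -> x \in L t -> x = x0.
  rewrite !inE => /andP[xW /same_lineP[s xs]] /andP[_ /same_lineP[s' xs']].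
  have s'0 : s' = 0.
    by apply: (addrI (x0 o)); rewrite -xs' 1?eq_sym // addr0; apply: constW.
  have [h [ho ht]] := third_direction o t.
  have s0 : s = 0 by apply: (addrI (x0 h)); rewrite -xs // xs' // s'0.
  apply/ffunP => i; have [->|io] := eqVneq i o; first exact: constW.
  by rewrite xs // s0 addr0.
have WZ : (Q o + Q t <= #|W :\: Z|)%N.
  apply: leq_trans (_ : #|L o :\ x0| + #|L t :\ x0| <= _)%N.
    have cardL l : (#|L l :\ x0|.+1 = #|L l|)%N by rewrite [RHS](cardsD1 x0) x0L.
    by apply: leq_add; rewrite -ltnS cardL.
  rewrite -cardsUI (_ : (_ :\ _) :&: _ = set0) ?cards0 ?addn0.
    apply: subset_leq_card; apply/subsetP => x; rewrite in_setU !in_setD1 in_setD.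
    have LW l : x \in L l -> x \in W by rewrite inE => /andP[].
    case/orP => /andP[xx0 xL]; rewrite (LW _ xL) andbT; apply: contra xx0 => xZ.
      by rewrite (LoZ x).
    by rewrite (LtZ x).
  apply/setP => x; rewrite !inE; apply/negP => /andP[/andP[xx0 xo] /andP[_ xt]].
  by case/eqP: xx0; apply: Lot; rewrite inE.
have ZQ : (#|Z| <= \sum_(l in D :\ t) Q l)%N.
  have split : (\sum_l Q l = Q o + Q t + \sum_(l in D :\ t) Q l)%N.
    rewrite (bigID (mem (o |: D))) /= [X in (_ + X)%N]big1 ?addn0 => [|l /suppQ //].
    by rewrite big_setU1 //= (big_setD1 t) //= addnA.
  by move: sumQ; rewrite split -(cardsID Z W) (setIidPr sZ); lia.
have [Q1 [leQ1 outQ1 sumQ1]] := split_quota ZQ.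
apply: (@schedulable_split W Z Q Q1) => //.
- move=> l x y Q1l xZ yW xy.
  have lD : l \in D :\ t by apply: contraLR Q1l => /outQ1 ->.
  move: lD xZ; rewrite !inE => /andP[lt lD] /andP[xW /eqP <-]; rewrite yW /=.
  case/same_lineP: xy => s xs.
  have lo : l != o by apply: contraNneq oD => <-.
  have s0 : s = 0 by apply: (addrI (x o)); rewrite -xs 1?eq_sym // addr0; apply: constW.
  by rewrite xs 1?eq_sym // s0 addr0.
- apply: (IHD (D :\ t)).
  + by apply: leq_trans Dn; rewrite [leqRHS](cardsD1 t) tD.
  + by rewrite inE (negPf oD) andbF.
  + move=> x y i; rewrite !inE => /andP[xW /eqP xt] /andP[yW /eqP yt].
    by rewrite negb_and negbK => /orP[/eqP->|]; [rewrite xt yt | apply: constW].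
  + by move=> l; rewrite !inE negb_or => /andP[_ lD]; apply: outQ1; rewrite !inE.
  + by rewrite sumQ1.
- apply: IHW.
  + apply: leq_trans Wn; apply: proper_card; apply/properP.
    by split; [apply: subsetDl | exists x0; rewrite // !inE x0W eqxx].
  + by move=> x y i /setDP[xW _] /setDP[yW _]; apply: constW.
  + by move=> l' /suppQ ->; rewrite sub0n.
  + rewrite cardsD (setIidPr sZ) leq_subLR -[in leqRHS]sumQ1 -big_split /=.
    by apply: leq_trans sumQ _; apply: leq_sum => l' _; lia.
Qed.

End Schedules.

(** * Cells of the cube modulo diagonal translation *)

Section Cells.
Variables (G : finZmodType) (k : nat) (o : 'I_k).
Hypothesis k_ge3 : (3 <= k)%N.
Local Notation X := {ffun 'I_k -> G}.

(** The representative with [x o = 0] of the orbit under diagonal translation. *)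
Definition cell (p : X) : X := [ffun i => p i - p o].

Lemma cell_line l p x : same_line l x (cell p) = same_line l x p.
Proof.
have pc : same_line l p (cell p).
  by apply/same_lineP; exists (- p o) => i _; rewrite ffunE.
apply/idP/idP => xp; last exact: same_line_trans xp pc.
by apply: same_line_trans xp _; rewrite same_line_sym.
Qed.

Lemma cell_inj_at l p q : cell p = cell q -> p l = q l -> p = q.
Proof.
move=> /ffunP pq l_eq; have oE : p o = q o.
  by have := pq l; rewrite !ffunE l_eq => /addrI/oppr_inj.
by apply/ffunP => i; have := pq i; rewrite !ffunE oE => /addIr.
Qed.

(** The cells of the positions that do not have [k - 1] equal coordinates. *)
Definition far_cells := [set x : X | (x o == 0) && [forall l, ~~ same_line l 0 x]].

Lemma cellN_far p : cell p \notin far_cells -> exists l, same_line l 0 p.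
Proof.
rewrite inE ffunE subrr eqxx /= negb_forall => /existsP[l].
by rewrite negbK cell_line; exists l.
Qed.

Definition single l (a : G) : X := [ffun i => if i == l then a else 0].

(** The lines through 0 in the [k] directions meet only at 0; this needs a third
    direction. *)
Lemma cell_single_inj : {in setX [set: 'I_k] (~: [set 0]) &,
  injective (fun la : 'I_k * G => cell (single la.1 la.2))}.
Proof.
move=> [l a] [l' a']; rewrite !inE /= => a0 a'0 /ffunP E.
have [lo|lo] := eqVneq l o; have [l'o|l'o] := eqVneq l' o.
- have [i [io _]] := third_direction k_ge3 o o.
  have := E i; rewrite !ffunE lo l'o (negPf io) eqxx !sub0r => /oppr_inj ->.
  by [].
- have [i [io il']] := third_direction k_ge3 o l'.
  have := E i; rewrite !ffunE lo (negPf io) eqxx (negPf il') eq_sym (negPf l'o).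
  by rewrite sub0r subr0 => /eqP; rewrite oppr_eq0 (negPf a0).
- have [i [io il]] := third_direction k_ge3 o l.
  have := E i; rewrite !ffunE l'o (negPf io) eqxx (negPf il) eq_sym (negPf lo).
  by rewrite subrr sub0r => /eqP; rewrite eq_sym oppr_eq0 (negPf a'0).
- have := E l; rewrite !ffunE eqxx ![o == _]eq_sym (negPf lo) (negPf l'o) !subr0.
  by case: eqP => [-> -> //|_ /eqP]; rewrite (negPf a0).
Qed.

(** The cells left out are 0 and the other points of the [k] lines through it. *)
Lemma card_far_cells : (#|far_cells| + 1 + k * #|G|.-1 <= #|G| ^ k.-1)%N.
Proof.
pose C := [set x : X | x o == 0].
have -> : (#|G| ^ k.-1 = #|C|)%N.
  have <- : #|pffun_on (0 : G) (predC1 o) (@predT G)| = #|C|.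
    apply: eq_card => x; rewrite !inE; apply/pffun_onP/eqP => [[sup _]|xo].
      by apply: contraTeq isT => xo; have := subsetP sup o; rewrite !inE xo eqxx => /(_ isT).
    by split=> //; apply/subsetP => i; rewrite !inE; apply: contraNneq => ->; rewrite xo.
  by rewrite card_pffun_on cardC1 card_ord.
pose S := setX [set: 'I_k] (~: [set (0 : G)]).
have <- : #|(fun la : 'I_k * G => cell (single la.1 la.2)) @: S| = (k * #|G|.-1)%N.
  by rewrite (card_in_imset cell_single_inj) cardsX cardsT card_ord cardsC1.
set I := _ @: S.
have far0 : 0 \notin far_cells.
  rewrite inE ffunE eqxx /= negb_forall; apply/existsP; exists o.
  by rewrite negbK same_line_refl.
have dI : [disjoint (0 : X) |: far_cells & I].
  rewrite disjoint_sym disjoints_subset; apply/subsetP => _ /imsetP[[l a] + ->] /=.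
  rewrite !inE /= => a0; rewrite negb_or; apply/andP; split.
    have [i [il io]] := third_direction k_ge3 l l.
    apply: contra a0 => /eqP/ffunP E; have [lo|lo] := eqVneq l o.
      have := E i; rewrite !ffunE -lo eqxx (negPf il) sub0r => /eqP.
      by rewrite oppr_eq0.
    by have := E l; rewrite !ffunE eqxx eq_sym (negPf lo) subr0 => ->.
  rewrite negb_and; apply/orP; right; rewrite negb_forall; apply/existsP; exists l.
  rewrite negbK cell_line; apply/same_lineP; exists 0 => i il.
  by rewrite !ffunE (negPf il) addr0.
have -> : (#|far_cells| + 1 = #|(0%R : X) |: far_cells|)%N by rewrite cardsU1 far0 addnC.
rewrite -cardsUI (disjoint_setI0 dI) cards0 addn0.
apply: subset_leq_card; apply/subsetP => x; rewrite !in_setU !inE.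
case/orP => [/orP[/eqP->|/andP[//]]|/imsetP[la _ ->]]; first by rewrite ffunE.
by rewrite ffunE subrr.
Qed.

End Cells.

(** A Cauchy matrix with at least as many rows as columns has trivial kernel: a
    kernel vector [f] makes [sum_p f p prod_(p' <> p) (X - xi p')], of degree below
    [#|B|], vanish at the [#|A|] points [eta y]; its value at [xi p] then shows [f p = 0]. *)
Lemma cauchy_kernel (K : fieldType) (P C : finType) (A : {set C}) (B : {set P})
    (xi : P -> K) (eta : C -> K) (f : P -> K) :
    {in B &, injective xi} -> {in A &, injective eta} ->
    (forall p y, p \in B -> y \in A -> xi p != eta y) ->
    (#|B| <= #|A|)%N ->
    (forall y, y \in A -> \sum_(p in B) f p / (xi p - eta y) = 0) ->
  forall p, p \in B -> f p = 0.
Proof.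
move=> xi_inj eta_inj xi_eta BA sum0 p0 p0B.
pose q : {poly K} := \sum_(p in B) f p *: \prod_(p' in B :\ p) ('X - (xi p')%:P).
have size_q : (size q <= #|B|)%N.
  apply: leq_trans (size_sum _ _ _) _; apply/bigmax_leqP => p pB.
  apply: leq_trans (size_scale_leq _ _) _.
  by rewrite -big_enum size_prod_XsubC -cardE (cardsD1 p B) pB.
have q0 : q = 0.
  apply/eqP; apply: contraT => q0.
  have := max_poly_roots q0 (_ : all (root q) (map eta (enum A))).
  rewrite size_map -cardE ltnNge (leq_trans size_q BA); apply.
    apply/allP => _ /mapP[y + ->]; rewrite mem_enum => yA.
    apply/eqP; rewrite horner_sum -[RHS](mulr0 (- \prod_(p in B) (eta y - xi p))).
    rewrite -[X in _ = _ * X](sum0 y yA) big_distrr /=; apply: eq_bigr => p pB.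
    rewrite hornerZ horner_prod (big_setD1 p pB) /=; under eq_bigr do rewrite hornerXsubC.
    have ne : xi p - eta y != 0 by rewrite subr_eq0 xi_eta.
    by set b := \prod_(_ in _) _; field.
  rewrite map_inj_in_uniq ?enum_uniq // => y y'; rewrite !mem_enum; exact: eta_inj.
have := congr1 (horner^~ (xi p0)) q0; rewrite horner0 horner_sum (bigD1 p0) //=.
rewrite [X in _ + X]big1 ?addr0 => [/eqP|p /andP[pB pp0]].
  rewrite hornerZ horner_prod mulf_eq0 => /orP[/eqP->//|/prodf_eq0[p]].
  rewrite !inE hornerXsubC subr_eq0 => /andP[pp0 pB] /eqP/xi_inj E.
  by rewrite E ?eqxx // in pp0.
rewrite hornerZ horner_prod (big_setD1 p0) /=; last by rewrite !inE eq_sym pp0.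
by rewrite hornerXsubC subrr mul0r mulr0.
Qed.

Section Vanishing.
Variables (K : fieldType) (G : finZmodType) (k : nat) (o : 'I_k).
Local Notation X := {ffun 'I_k -> G}.
Variables (lab : X -> 'I_k) (time : X -> nat) (iota : X + X -> K).
Hypothesis iota_inj : injective iota.
Hypothesis timeP : forall x y, x \in far_cells G o -> y \in far_cells G o ->
  same_line (lab x) x y -> lab y != lab x -> (time y < time x)%N.

Definition erase l (p : X) : X := [ffun i => if i == l then 0 else p i].

(** The slice attached to the cell [x] labelled [l].  It does not depend on the
    coordinate [l] of [p], because neither the line nor [erase l p] does. *)
Definition cauchy_coef l (x p : X) : K :=
  if same_line l x p then (iota (inl (erase l p)) - iota (inr x))^-1 else 0.

(** Dual form of the spanning property.  By induction on time, in the equations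
    of the cells labelled [l] on one line only the positions in
    these same cells survive, and the square Cauchy system makes [f] vanish there. *)
Lemma vanishing_of_schedule (f : X -> K) :
    (forall l p, same_line l 0 p -> f p = 0) ->
    (forall (x : X) c, x \in far_cells G o ->
       \sum_(p : X | p (lab x) == c) f p * cauchy_coef (lab x) x p = 0) ->
  forall p, f p = 0.
Proof.
move=> f_near f_sum.
have f_far x : x \in far_cells G o -> forall p, cell o p = x -> f p = 0.
  have [n] := ubnP (time x); elim: n x => // n IH x /ltnSE xn xO p px.
  set l := lab x.
  pose B := [set q : X | [&& q l == p l,
    same_line l x q, cell o q \in far_cells G o & lab (cell o q) == l]].
  pose A := [set y in far_cells G o | same_line l x y && (lab y == l)].
  apply: (@cauchy_kernel K _ _ A B (fun q => iota (inl (erase l q))) (fun y => iota (inr y))).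
  - move=> q q'; rewrite !inE => /and4P[/eqP ql _ _ _] /and4P[/eqP q'l _ _ _] /iota_inj[/ffunP E].
    apply/ffunP => i; have [->|il] := eqVneq i l; first by rewrite ql q'l.
    by have := E i; rewrite !ffunE (negPf il).
  - by move=> y y' _ _ /iota_inj[].
  - by move=> q y _ _; apply/eqP => /iota_inj.
  - have cB : {in B &, injective (cell o)}.
      move=> q q'; rewrite !inE => /and4P[/eqP ql _ _ _] /and4P[/eqP q'l _ _ _] E.
      by apply: (cell_inj_at (l := l)) E _; rewrite ql q'l.
    rewrite -(card_in_imset cB); apply: subset_leq_card; apply/subsetP => _ /imsetP[q + ->].
    by rewrite !inE cell_line => /and4P[_ -> -> ->].
  - move=> y; rewrite inE => /and3P[yO xy /eqP yl].
    have := f_sum y (p l) yO; rewrite yl => E; rewrite -[RHS]E.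
    rewrite [RHS](bigID (mem B)) /= [X in _ = _ + X]big1 ?addr0.
      apply: eq_big => [q|q]; first by rewrite inE; case: eqP.
      rewrite inE /cauchy_coef => /and4P[_ xq _ _].
      by rewrite (same_line_trans _ xq) // same_line_sym.
    move=> q /andP[/eqP ql]; rewrite inE ql eqxx /= /cauchy_coef => qB.
    case: ifP => yq; last by rewrite mulr0.
    have xq : same_line l x q by apply: same_line_trans xy yq.
    move: qB; rewrite xq /=; have [qO /= ql'|qO _] := boolP (cell o q \in far_cells G o).
      rewrite (IH (cell o q)) ?mul0r //.
      by apply: leq_trans xn; apply: timeP; rewrite // cell_line.
    by have [l' /f_near ->] := cellN_far qO; rewrite mul0r.
  - by rewrite inE eqxx px xO eqxx andbT /= -(cell_line o) px same_line_refl.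
move=> p; have [pO|pO] := boolP (cell o p \in far_cells G o); first exact: f_far pO p erefl.
by have [l /f_near ->] := cellN_far pO.
Qed.

End Vanishing.

(** * Restriction of tensors and the unit tensor *)

Lemma prod_sum_dffun (R : comNzRingType) (I : finType) (T : I -> finType)
    (F : forall i, T i -> R) :
  \prod_i \sum_(x : T i) F i x = \sum_(f : {dffun forall i, T i}) \prod_i F i (f i).
Proof.
pose P i := [ffun x => F i x].
transitivity (\prod_i \sum_(x : T i) P i x).
  by apply: eq_bigr => i _; apply: eq_bigr => x _; rewrite ffunE.
under eq_bigr => i _ do rewrite (big_tag (fun i x => P i x)).
rewrite bigA_distr_big_dep -(big_fprod _ _ P).
rewrite (reindex (@fprod_of_dffun I T)); last exact/onW_bij/fprod_of_dffun_bij.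
by apply: eq_bigr => f _; apply: eq_bigr => i _; rewrite fprodE ffunE.
Qed.

Section Tensors.
Variables (K : fieldType) (k : nat).

Lemma eq_tensor_map (m n : 'I_k -> nat) (A B : forall l, 'M[K]_(m l, n l)) T :
  (forall l, A l = B l) -> tensor_map A T = tensor_map B T.
Proof.
move=> AB; apply/ffunP => j; rewrite !ffunE; apply: eq_bigr => i _.
by congr (_ * _); apply: eq_bigr => l _; rewrite AB.
Qed.

Lemma tensor_map_comp (m n q : 'I_k -> nat) (A : forall l, 'M[K]_(m l, n l))
    (B : forall l, 'M[K]_(n l, q l)) (T : tensor K q) :
  tensor_map A (tensor_map B T) = tensor_map (fun l => A l *m B l) T.
Proof.
apply/ffunP => j; rewrite !ffunE.
under eq_bigr => i _ do rewrite ffunE big_distrr /=.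
rewrite exchange_big; apply: eq_bigr => i _ /=.
under [in RHS]eq_bigr => l _ do rewrite mxE.
rewrite prod_sum_dffun big_distrl; apply: eq_bigr => h _ /=.
by rewrite big_split mulrA.
Qed.

Lemma prod_delta (R : comNzRingType) (I : finType) (b : pred I) :
  \prod_i (b i)%:R = [forall i, b i]%:R :> R.
Proof.
have [/forallP bi|/forallPn[i /negPf bi]] := boolP [forall i, b i].
  by rewrite big1 // => i _; rewrite bi.
by rewrite (bigD1 i) //= bi mul0r.
Qed.

Lemma tensor_map_id (n : 'I_k -> nat) (T : tensor K n) :
  tensor_map (fun l => 1%:M) T = T.
Proof.
apply/ffunP => j; rewrite !ffunE (bigD1 j) //= [X in _ + X]big1.
  by rewrite addr0 big1 ?mul1r // => l _; rewrite mxE eqxx.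
move=> i ij; under eq_bigr => l _ do rewrite mxE.
rewrite prod_delta; case: forallP => [E|]; rewrite ?mul0r //.
by case/eqP: ij; apply/ffunP => l; rewrite (eqP (E l)).
Qed.

Lemma tensor_le_trans (m n q : 'I_k -> nat) (S : tensor K m) (T : tensor K n) (U : tensor K q) :
  tensor_le S T -> tensor_le T U -> tensor_le S U.
Proof.
move=> [A <-] [B <-]; exists (fun l => A l *m B l); by rewrite tensor_map_comp.
Qed.

Lemma unit_tensorE s (j : tindex (fun _ : 'I_k => s)) :
  unit_tensor K k s j = \sum_(a < s) [forall l, j l == a]%:R.
Proof.
rewrite ffunE; apply: eq_bigr => a _; rewrite ffunE -prod_delta.
by apply: eq_bigr => l _; rewrite mxE eqxx andbT.
Qed.

Lemma tensor_map_unit s (m : 'I_k -> nat) (A : forall l, 'M[K]_(m l, s)) j :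
  tensor_map A (unit_tensor K k s) j = \sum_(a < s) \prod_l A l (j l) a.
Proof.
rewrite ffunE; under eq_bigr => i _ do rewrite unit_tensorE big_distrr /=.
rewrite exchange_big; apply: eq_bigr => a _ /=.
pose c : tindex (fun _ : 'I_k => s) := [ffun=> a].
rewrite (bigD1 c) //= [X in _ + X]big1 ?addr0 => [|i ic].
  rewrite (_ : [forall l, _]) ?mulr1; last by apply/forallP => l; rewrite ffunE.
  by apply: eq_bigr => l _; rewrite ffunE.
case: forallP => [E|]; rewrite ?mulr0 //.
by case/eqP: ic; apply/ffunP => l; rewrite ffunE (eqP (E l)).
Qed.

Lemma unit_tensor_le r s : (0 < k)%N -> (r <= s)%N ->
  tensor_le (unit_tensor K k r) (unit_tensor K k s).
Proof.
move=> k0 rs; exists (fun l => \matrix_(a, b) (a == b :> nat)%:R).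
apply/ffunP => j; rewrite tensor_map_unit unit_tensorE.
under eq_bigr => a _.
  under eq_bigr => l _ do rewrite mxE.
  rewrite prod_delta; over.
rewrite (bigID (fun a : 'I_s => a < r)%N) /= [X in _ + X]big1 ?addr0; last first.
  move=> a; rewrite -leqNgt => ra; case: forallP => // /(_ (Ordinal k0)) /eqP E.
  by have := ltn_ord (j (Ordinal k0)); rewrite E ltnNge ra.
rewrite (reindex_onto (widen_ord rs) (fun a => insubd (j (Ordinal k0)) (val a))) /=.
  apply: eq_bigl => a; rewrite ltn_ord /=.
  by apply/eqP; apply: val_inj; rewrite val_insubd ltn_ord.
by move=> a ar; apply: val_inj; rewrite /= val_insubd ar.
Qed.

(** Contracting all directions but [l] with the row [b] turns the identity
    [A T = I_s] into the flattening identity [A_l B = 1]. *)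
Lemma unit_tensor_le_factor s (n : 'I_k -> nat) (T : tensor K n)
    (A : forall l, 'M[K]_(s, n l)) : (1 < k)%N ->
  tensor_map A T = unit_tensor K k s -> forall l, exists B, A l *m B = 1%:M.
Proof.
move=> k1 AT l.
exists (\matrix_(x, b) \sum_(i : tindex n | i l == x) (\prod_(l' < k | l' != l) A l' b (i l')) * T i).
apply/matrixP => a b; rewrite !mxE.
pose j : tindex (fun _ : 'I_k => s) := [ffun l' => if l' == l then a else b].
have := congr1 (fun S : tensor K _ => S j) AT; rewrite ffunE unit_tensorE => E.
transitivity (\sum_(c < s) [forall l', j l' == c]%:R : K).
  rewrite -E (partition_big (fun i : tindex n => i l) predT) //=.
  apply: eq_bigr => x _; rewrite mxE big_distrr; apply: eq_bigr => i /eqP <- /=.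
  rewrite [in RHS](bigD1 l) //= /j ffunE eqxx mulrA; congr (_ * _ * _).
  by apply: eq_bigr => l' /negPf l'l; rewrite ffunE l'l.
have [l' l'l] : exists l', l' != l.
  have : (0 < #|predC1 l|)%N by rewrite cardC1 card_ord; lia.
  by case/card_gt0P => l'; exists l'.
rewrite (bigD1 b) //= big1 ?addr0 => [|c cb].
  congr (_ %:R); apply: congr1; apply/forallP/eqP => [/(_ l)|ab l''].
    by rewrite ffunE eqxx => /eqP.
  by rewrite ffunE ab if_same.
case: forallP => // /(_ l'); rewrite ffunE (negPf l'l) => /eqP E'.
by rewrite E' eqxx in cb.
Qed.

Lemma subrank_bound s (n : 'I_k -> nat) (T : tensor K n) : (1 < k)%N ->
  tensor_le (unit_tensor K k s) T -> forall l, (s <= n l)%N.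
Proof.
move=> k1 [A AT] l; have [B AB] := unit_tensor_le_factor k1 AT l.
by rewrite -(mxrank1 K s) -AB (leq_trans (mxrankM_maxl _ _)) // rank_leq_col.
Qed.

(** The subrank exists because [subrank_bound] bounds the sizes of unit tensors
    below [T]; choosing it needs excluded middle. *)
Lemma subrank_geE r (n : 'I_k -> nat) (T : tensor K n) : (1 < k)%N ->
  subrank_ge r T <-> tensor_le (unit_tensor K k r) T.
Proof.
move=> k1; have k0 := ltnW k1; split=> [[q [[qT _] rq]]|rT].
  exact: tensor_le_trans (unit_tensor_le k0 rq) qT.
pose l0 := Ordinal k0.
have [d] := ubnP (n l0 - r); elim: d r rT => // d IH r rT /ltnSE nd.
have [[s [sT rs]]|max] := classic (exists s, tensor_le (unit_tensor K k s) T /\ (r < s)%N).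
  have sn := subrank_bound k1 sT l0.
  have [|q [qT sq]] := IH s sT; first by lia.
  by exists q; split=> //; apply: leq_trans sq; apply: ltnW.
exists r; split=> //; split=> // s sT; rewrite leqNgt; apply/negP => rs.
by apply: max; exists s.
Qed.

End Tensors.

(** * Deforming a tensor with a unit corner *)

Lemma solvable_by_duality (K : fieldType) (I J : finType) (g : I -> J -> K) :
    (forall f : J -> K, (forall i, \sum_j f j * g i j = 0) -> forall j, f j = 0) ->
  forall y : J -> K, exists a : I -> K, forall j, y j = \sum_i a i * g i j.
Proof.
move=> dual y.
pose M := \matrix_(i < #|I|, j < #|J|) g (enum_val i) (enum_val j).
have fullM : row_full M.
  rewrite -cokermx_eq0; apply/eqP/matrixP => j0 c; rewrite [RHS]mxE -(enum_valK j0).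
  apply: (dual (fun j => cokermx M (enum_rank j) c)) => i.
  have := congr1 (fun N : 'M_(_, _) => N (enum_rank i) c) (mulmx_coker M).
  rewrite mxE [RHS]mxE => E; rewrite -[RHS]E (reindex (@enum_rank J)) /=; last first.
    by exists enum_val => x _; [apply: enum_rankK | apply: enum_valK].
  by apply: eq_bigr => j _; rewrite [M _ _]mxE !enum_rankK mulrC.
have /submxP[D yD] := submx_full (\row_(j < #|J|) y (enum_val j)) fullM.
exists (fun i => D 0 (enum_rank i)) => j.
have := congr1 (fun N : 'rV_ _ => N 0 (enum_rank j)) yD; rewrite mxE [RHS]mxE enum_rankK => ->.
rewrite (reindex (@enum_rank I)) /=; last first.
  by exists enum_val => x _; [apply: enum_rankK | apply: enum_valK].
by apply: eq_bigr => i _; rewrite [M _ _]mxE !enum_rankK.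
Qed.

Lemma coef0_prod (R : comNzRingType) (I : finType) (F : I -> {poly R}) :
  (\prod_i F i)`_0 = \prod_i (F i)`_0.
Proof.
rewrite -horner_coef0 horner_prod; apply: eq_bigr => i _; exact: horner_coef0.
Qed.

Lemma coef1_prod (R : comNzRingType) (I : finType) (F : I -> {poly R}) :
  (\prod_i F i)`_1 = \sum_i (F i)`_1 * \prod_(j | j != i) (F j)`_0.
Proof.
have coef1M (p q : {poly R}) : (p * q)`_1 = p`_0 * q`_1 + p`_1 * q`_0.
  by rewrite coefM !big_ord_recl big_ord0 addr0.
elim: (index_enum I) (index_enum_uniq I) => [|i s IH] /=; first by rewrite !big_nil coef1.
case/andP=> iS uS; rewrite !big_cons coef1M IH // eqxx /= addrC; congr (_ + _).
  congr (_ * _).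
  rewrite (_ : \prod_(j <- s | j != i) _ = \prod_(j <- s) (F j)`_0).
    by elim: (s) => [|j s' E]; rewrite ?big_nil ?coef1 // !big_cons coefM big_ord1 E.
  rewrite big_seq_cond [RHS]big_seq; apply: eq_bigl => j.
  by rewrite andb_idr // => js; apply: contraNneq iS => <-.
rewrite big_distrr big_seq [RHS]big_seq; apply: eq_bigr => j js /=.
have ij : i != j by apply: contraNneq iS => ->.
by rewrite big_cons ij mulrCA.
Qed.

Section Deformation.
Variables (K : fieldType) (infK : infinite_type K) (k r : nat) (n : 'I_k -> nat).
Hypothesis rn : forall l, (r <= n l)%N.
Local Notation X := {ffun 'I_k -> 'I_r}.

Definition corner (p : X) : tindex n := [ffun l => widen_ord (rn l) (p l)].

Definition set_coord (j : tindex n) l (x : 'I_(n l)) : tindex n := [ffun l' => dfwith j x l'].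

Lemma set_coord_in j l x : @set_coord j l x l = x.
Proof. by rewrite ffunE dfwith_in. Qed.

Lemma set_coord_out j l x l' : l' != l -> @set_coord j l x l' = j l'.
Proof. by move=> ne; rewrite ffunE dfwith_out // eq_sym. Qed.

Definition has_unit_corner (T : tensor K n) :=
  forall p : X, T (corner p) = \sum_(a < r) [forall l, p l == a]%:R.

(** Dual statement of: the corner is spanned by the tensors having, for some [l],
    [a] and [x], the slice [x] of [T] in direction [l] as their slice [a] in that
    direction, and zeros elsewhere. *)
Definition corner_spanning (T : tensor K n) := forall f : X -> K,
  (forall l a x, \sum_(p : X | p l == a) f p * T (@set_coord (corner p) l x) = 0) ->
  forall p, f p = 0.

Lemma unit_corner_le T : has_unit_corner T -> tensor_le (unit_tensor K k r) T.
Proof.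
move=> cT; exists (fun l => \matrix_(a, x) (widen_ord (rn l) a == x)%:R).
apply/ffunP => j; rewrite unit_tensorE ffunE.
pose p : X := [ffun l => j l].
rewrite (bigD1 (corner p)) //= [X in _ + X]big1 => [|i ij].
  rewrite addr0 cT big1 ?mul1r => [|l _]; last by rewrite mxE !ffunE eqxx.
  by apply: eq_bigr => a _; congr (_%:R); apply: congr1; apply: eq_forallb => l; rewrite ffunE.
under eq_bigr => l _ do rewrite mxE.
rewrite prod_delta; case: forallP => [E|]; rewrite ?mul0r //.
by case/eqP: ij; apply/ffunP => l; rewrite -(eqP (E l)) !ffunE.
Qed.

(** The derivative at [t = 0] of the action of [1 + t E]. *)
Definition infinitesimal (E : forall l, 'M[K]_(n l)) (T : tensor K n) : tensor K n :=
  [ffun j : tindex n => \sum_l \sum_x E l (j l) x * T (@set_coord j l x)].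

Definition curve (E : forall l, 'M[K]_(n l)) (T U : tensor K n) (j : tindex n) : {poly K} :=
  \sum_(i : tindex n) (\prod_(l < k) ((j l == i l)%:R%:P + (E l (j l) (i l))%:P * 'X)) *
    ((T i)%:P + (U i)%:P * 'X).

Lemma coef_linear (a b : K) : ((a%:P + b%:P * 'X)`_0 = a) * ((a%:P + b%:P * 'X)`_1 = b).
Proof. by rewrite !coefD !coefMX !coefC /= addr0 add0r. Qed.

Lemma horner_curve E T U t :
  [ffun j : tindex n => (curve E T U j).[t]] =
  tensor_map (fun l => 1%:M + t *: E l) [ffun j => T j + t * U j].
Proof.
apply/ffunP => j; rewrite !ffunE horner_sum; apply: eq_bigr => i _.
rewrite hornerM horner_prod ffunE hornerD hornerMX !hornerC [U i * t]mulrC.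
congr (_ * _); apply: eq_bigr => l _.
by rewrite hornerD hornerMX !hornerC !mxE [t * _]mulrC.
Qed.

Lemma curve_coef0 E T U j : (curve E T U j)`_0 = T j.
Proof.
rewrite coef_sum (bigD1 j) //= [X in _ + X]big1 => [|i ij].
  rewrite addr0 coefM big_ord1 coef_linear coef0_prod big1 ?mul1r // => l _.
  by rewrite coef_linear eqxx.
rewrite coefM big_ord1 coef0_prod; under eq_bigr => l _ do rewrite coef_linear.
rewrite prod_delta; case: forallP => [E'|]; rewrite ?mul0r //.
by case/eqP: ij; apply/ffunP => l; rewrite (eqP (E' l)).
Qed.

Lemma sum_one_coordinate (F : tindex n -> K) (j : tindex n) l :
  \sum_(i : tindex n | [forall l', (l' != l) ==> (j l' == i l')]) F i =
  \sum_x F (@set_coord j l x).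
Proof.
rewrite (reindex_onto (@set_coord j l) (fun i : tindex n => i l)) /=.
  apply: eq_bigl => x; rewrite set_coord_in eqxx andbT.
  by apply/forallP => l'; apply/implyP => l'l; rewrite set_coord_out.
move=> i /forallP E; apply/ffunP => l'.
have [->|l'l] := eqVneq l' l; first by rewrite set_coord_in.
by rewrite set_coord_out //; apply/eqP; move/implyP: (E l'); apply.
Qed.

Lemma curve_coef1 E T U j : (curve E T U j)`_1 = infinitesimal E T j + U j.
Proof.
rewrite coef_sum /infinitesimal ffunE.
have -> : U j = \sum_(i : tindex n) [forall l, j l == i l]%:R * U i.
  rewrite (bigD1 j) //= big1 => [|i ij].
    by rewrite (_ : [forall l, _]) ?mul1r ?addr0 //; apply/forallP => l.
  case: forallP => [E'|]; rewrite ?mul0r //.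
  by case/eqP: ij; apply/ffunP => l; rewrite (eqP (E' l)).
have -> : \sum_l \sum_x E l (j l) x * T (@set_coord j l x) =
    \sum_(i : tindex n) \sum_l [forall l', (l' != l) ==> (j l' == i l')]%:R *
       (E l (j l) (i l) * T i).
  rewrite exchange_big; apply: eq_bigr => l _ /=.
  under eq_bigr => x _ do rewrite -{1}[x](set_coord_in j).
  rewrite -(sum_one_coordinate (fun i => E l (j l) (i l) * T i)) big_mkcond.
  by apply: eq_bigr => i _; case: ifP; rewrite ?mul1r ?mul0r.
rewrite -big_split; apply: eq_bigr => i _ /=.
rewrite coefM !big_ord_recl big_ord0 addr0 /= !coef_linear [RHS]addrC coef0_prod coef1_prod.
congr (_ + _).
  by under eq_bigr => l _ do rewrite coef_linear; rewrite prod_delta.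
rewrite big_distrl; apply: eq_bigr => l _ /=; rewrite coef_linear mulrA; congr (_ * _).
rewrite mulrC; congr (_ * _); rewrite big_mkcond /= -prod_delta.
by apply: eq_bigr => l' _; rewrite coef_linear; case: (l' != l).
Qed.

(** Its value at 0 makes [d] a nonzero polynomial, so that [1 + t E] is invertible
    for all but finitely many [t]. *)
Lemma det_near_identity m (E : 'M[K]_m) :
  exists2 d : {poly K}, d.[0] = 1 & forall t, d.[t] = \det (1%:M + t *: E).
Proof.
pose M : 'M[{poly K}]_m := 1%:M + 'X *: map_mx polyC E.
have dt t : (\det M).[t] = \det (1%:M + t *: E).
  rewrite -horner_evalE -det_map_mx; congr (\det _); apply/matrixP => i j.
  by rewrite !mxE -[LHS]/((_ + _).[t]) hornerD hornerM hornerX hornerC -polyC_natr hornerC.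
by exists (\det M) => //; rewrite dt scale0r addr0 det1.
Qed.

(** Given a velocity [Y], the spanning property provides [E] such that the
    derivative of the action of [1 + t E] has the same corner as [Y]; the
    direction [U] accounts for the rest of [Y] and preserves the unit corner. *)
Lemma dense_of_corner_spanning (T : tensor K n) (p : tpoly K n) :
    has_unit_corner T -> corner_spanning T ->
    (forall S, tensor_le (unit_tensor K k r) S -> tpoly_eval p S = 0) ->
  forall S, tpoly_eval p S = 0.
Proof.
move=> cT ndT p0 S.
apply: (@vanishing_of_curves K infK _ p (fun i => T (enum_val i))) => Y.
pose I := {l : 'I_k & ('I_r * 'I_(n l))%type}.
pose g (e : I) (q : X) : K := (q (tag e) == (tagged e).1)%:R *
  T (@set_coord (corner q) (tag e) (tagged e).2).
have [a aY] : exists a : I -> K, forall q, Y (enum_rank (corner q)) = \sum_e a e * g e q.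
  apply: (@solvable_by_duality K I _ g _ (fun q => Y (enum_rank (corner q)))) => f fg.
  apply: ndT => l b x.
  have := fg (Tagged (fun l => ('I_r * 'I_(n l))%type) (b, x)); rewrite /g /= => E.
  rewrite -[RHS]E big_mkcond /=; apply: eq_bigr => q _.
  by case: eqP; rewrite ?mul1r ?mul0r ?mulr0.
pose E l : 'M[K]_(n l) := \matrix_(y, x)
  if insub (val y) is Some b then a (Tagged (fun l => ('I_r * 'I_(n l))%type) (b, x)) else 0.
pose U : tensor K n := [ffun j : tindex n => Y (enum_rank j) - infinitesimal E T j].
have cU q : U (corner q) = 0.
  rewrite !ffunE aY; apply/eqP; rewrite subr_eq0; apply/eqP.
  pose F l (bx : 'I_r * 'I_(n l)) := a (Tagged (fun l => ('I_r * 'I_(n l))%type) bx) *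
    g (Tagged (fun l => ('I_r * 'I_(n l))%type) bx) q.
  transitivity (\sum_l \sum_bx F l bx).
    by rewrite sig_big_dep /=; apply: eq_bigr => -[].
  apply: eq_bigr => l _; transitivity (\sum_b \sum_x F l (b, x)).
    by rewrite pair_bigA; apply: eq_bigr => -[].
  rewrite (bigD1 (q l)) //= [X in _ + X]big1 ?addr0 => [|b bq].
    apply: eq_bigr => x _; rewrite /F /g /= eqxx mul1r; congr (_ * _).
    by rewrite mxE ffunE /= insubT //= => ?; congr (a (Tagged _ (_, _))); apply: val_inj.
  by apply: big1 => x _; rewrite /F /g /= eq_sym (negPf bq) mul0r mulr0.
have /fin_all_exists2[d d1 dE] l := det_near_identity (E l).
exists (fun i => curve E T U (enum_val i)), (\prod_l d l); split.
- apply/eqP => /(congr1 (horner^~ 0)) /eqP; rewrite horner0 horner_prod.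
  by rewrite big1 ?oner_eq0.
- by move=> i; rewrite curve_coef0.
- by move=> i; rewrite curve_coef1 [U _]ffunE enum_valK addrC subrK.
move=> t; rewrite horner_prod => /prodf_neq0 dt.
pose V : tensor K n := [ffun j => T j + t * U j].
have := p0 [ffun j : tindex n => (curve E T U j).[t]].
rewrite /tpoly_eval => <-; last first.
  apply: (@tensor_le_trans _ _ _ _ _ _ V).
    by apply: unit_corner_le => q; rewrite ffunE cU mulr0 addr0 cT.
  exists (fun l => invmx (1%:M + t *: E l)).
  rewrite horner_curve tensor_map_comp -[RHS]tensor_map_id.
  apply: eq_tensor_map => l.
  by rewrite mulVmx // unitmxE unitfE -dE dt.
by apply: meval_eq => i; rewrite ffunE.
Qed.

End Deformation.

(** * A tensor whose deformations fill the space *)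

Section Construction.
Variables (K : fieldType) (k r' : nat) (n : 'I_k -> nat).
Local Notation r := r'.+1.
Local Notation X := {ffun 'I_k -> 'I_r}.
Hypothesis rn : forall l, (r <= n l)%N.
Variable S : 'I_k -> nat -> X -> K.

(** Indices outside the corner are sent to 0, which agrees with [erase] when just
    one coordinate is outside. *)
Definition shadow (j : tindex n) : X := [ffun l => insubd ord0 (val (j l))].

(** The unit tensor in the corner, extended by the slice [S l j] in direction [l]
    at index [r + j]. *)
Definition assemble : tensor K n := [ffun j : tindex n =>
  if [pick l | r <= j l]%N is Some l then S l (j l - r) (shadow j)
  else \sum_(a < r) [forall l, shadow j l == a]%:R : K].

Lemma corner_lt p l : (corner rn p l < r)%N.
Proof. by rewrite ffunE /= ltn_ord. Qed.

Lemma shadow_corner p : shadow (corner rn p) = p.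
Proof. by apply/ffunP => l; rewrite !ffunE; apply: val_inj; rewrite val_insubd /= ltn_ord. Qed.

Lemma assemble_corner : has_unit_corner rn assemble.
Proof.
move=> p; rewrite ffunE; case: pickP => [l|_]; last by rewrite shadow_corner.
by rewrite leqNgt corner_lt.
Qed.

Lemma assemble_set_coord p l (x : 'I_(n l)) : (r <= x)%N ->
  assemble (@set_coord _ _ (corner rn p) l x) = S l (x - r) (erase l p).
Proof.
move=> rx; rewrite ffunE; case: pickP => [l'|/(_ l)]; last by rewrite set_coord_in rx.
have [-> _|l'l] := eqVneq l' l; last by rewrite set_coord_out // leqNgt corner_lt.
rewrite set_coord_in; congr (S _ _ _); apply/ffunP => i; rewrite !ffunE; apply: val_inj.
have [->|il] := eqVneq i l; rewrite val_insubd.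
  by rewrite dfwith_in ltnNge rx.
by rewrite dfwith_out 1?eq_sym // corner_lt ffunE.
Qed.

Lemma assemble_set_coord_small p l (s : 'I_r) :
  assemble (@set_coord _ _ (corner rn p) l (widen_ord (rn l) s)) =
  [forall i, (i != l) ==> (p i == s)]%:R.
Proof.
pose q : X := [ffun i => if i == l then s else p i].
have -> : @set_coord _ _ (corner rn p) l (widen_ord (rn l) s) = corner rn q.
  apply/ffunP => i; have [->|il] := eqVneq i l; first by rewrite set_coord_in !ffunE eqxx.
  by rewrite set_coord_out // !ffunE (negPf il).
rewrite assemble_corner (bigD1 s) //= big1 ?addr0 => [|a sa].
  congr (_%:R); apply: congr1; apply: eq_forallb => i; rewrite ffunE.
  by case: (eqVneq i l) => //= _; rewrite eqxx.
by case: forallP => // /(_ l); rewrite ffunE eqxx eq_sym (negPf sa).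
Qed.

Lemma erase_idem l (p : X) : erase l (erase l p) = erase l p.
Proof. by apply/ffunP => i; rewrite !ffunE; case: eqP. Qed.

Lemma same_line_erase l (x p : X) : same_line l x (erase l p) = same_line l x p.
Proof.
by apply: eq_existsb => s; apply: eq_forallb => i; rewrite ffunE; case: eqP.
Qed.
End Construction.

(** The slices [x < r] of the corner tell that [f] vanishes at positions with [k - 1]
    equal coordinates; the slice at [r + j] is the one of the [j]-th cell
    labelled [l], so the quota of direction [l] is [n l - r]. *)
Lemma corner_spanning_exists (K : fieldType) (infK : infinite_type K) k r' (n : 'I_k -> nat)
    (rn : forall l, (r'.+1 <= n l)%N) :
    (3 <= k)%N -> (r'.+1 ^ k.-1 + k.-1 <= \sum_l n l)%N ->
  exists T : tensor K n, has_unit_corner rn T /\ corner_spanning rn T.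
Proof.
move=> k_ge3 sum_n; pose G : finZmodType := 'I_r'.+1.
have o : 'I_k by apply: (@Ordinal k 0); apply: leq_trans k_ge3.
pose W := far_cells G o; pose Q l := (n l - r'.+1)%N.
have [lab [time [card_lab timeP]]] : schedulable W Q.
  apply: (@schedulable_of_quota G k o k_ge3 [set~ o]).
  - by rewrite !inE eqxx.
  - by move=> x y i; rewrite !inE negbK => /andP[/eqP xo _] /andP[/eqP yo _] /eqP ->; rewrite xo yo.
  - by move=> l; rewrite !inE; case: eqP.
  have := card_far_cells G o k_ge3; rewrite card_ord /= -/W.
  rewrite /Q sumnB // sum_nat_const card_ord.
  rewrite mulnS; move: sum_n; move: (r'.+1 ^ _)%N (#|W|) (k * r')%N => a b c.
  by move: (\sum_(i < k) n i)%N => d; lia.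
have [iota iota_inj] := infinite_inj infK ({ffun 'I_k -> G} + {ffun 'I_k -> G})%type.
pose cells l := enum [set x in W | lab x == l].
pose S l j p := nth 0 [seq cauchy_coef iota l x p | x <- cells l] j.
exists (assemble n S); split; first exact: assemble_corner.
move=> f f_sum; apply: (vanishing_of_schedule iota_inj timeP) => [l p|x c xW].
  move=> /same_lineP[s ps].
  have := f_sum l (p l) (widen_ord (rn l) s); rewrite (bigD1 p) //= [X in _ + X]big1.
    rewrite addr0 assemble_set_coord_small.
    case: forallP => [_|[]]; first by rewrite mulr1.
    by move=> i; apply/implyP => /ps ->; rewrite ffunE add0r.
  move=> q /andP[/eqP ql qp]; rewrite assemble_set_coord_small.
  case: forallP => [E|_]; rewrite ?mulr0 //.
  case/eqP: qp; apply/ffunP => i; have [->//|il] := eqVneq i l.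
  by move/implyP: (E i) => /(_ il)/eqP->; rewrite ps // ffunE add0r.
pose l := lab x; have xl : x \in cells l by rewrite mem_enum inE xW eqxx.
have jx : (index x (cells l) < n l - r'.+1)%N.
  by apply: leq_trans (card_lab l); rewrite cardE index_mem.
have yn : (r'.+1 + index x (cells l) < n l)%N by move: jx (rn l); lia.
have := f_sum l c (Ordinal yn); rewrite -/l => E; rewrite -[RHS]E.
apply: eq_bigr => p _; congr (_ * _).
rewrite assemble_set_coord /= ?leq_addr // addKn /S.
rewrite (nth_map x) ?index_mem // nth_index //.
by rewrite /cauchy_coef same_line_erase erase_idem.
Qed.

Lemma unit_le_dense (K : fieldType) (infK : infinite_type K) k r (n : 'I_k -> nat)
    (p : tpoly K n) :
    (3 <= k)%N -> (forall l, r <= n l)%N -> (r ^ k.-1 + k.-1 <= \sum_l n l)%N ->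
    (forall S, tensor_le (unit_tensor K k r) S -> tpoly_eval p S = 0) ->
  forall S, tpoly_eval p S = 0.
Proof.
move=> k3; case: r => [_ _ p0 S|r rn sum_n p0].
  apply: p0; exists (fun l => 0); apply/ffunP => j.
  by case: (j (Ordinal (leq_trans (isT : 0 < 3)%N k3))).
have [T [cT ndT]] := corner_spanning_exists infK rn k3 sum_n.
exact: (dense_of_corner_spanning infK cT ndT p0).
Qed.

(** * A hypersurface containing all tensors of large subrank *)

(** The dependence of [mpoly_dependent] when some variables are frozen to
    constants: only the variables in [P] count. *)
Lemma mpoly_dependent_const (K : fieldType) (V J : finType) (P : pred V) (kappa : V -> K)
    (F : J -> {mpoly K[#|V|]}) : (#|P| < #|J|)%N ->
  exists2 p : {mpoly K[#|J|]}, p != 0 & forall theta : V -> K,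
    (forall v, ~~ P v -> theta v = kappa v) ->
    p.@[fun j => (F (enum_val j)).@[fun v => theta (enum_val v)]] = 0.
Proof.
move=> PJ; pose M := #|{: {v | P v}}|.
pose subst (v : V) : {mpoly K[M]} :=
  if insub v is Some s then 'X_(enum_rank s) else (kappa v)%:MP.
pose F' (j : 'I_#|J|) := F (enum_val j) \mPo [tuple subst (enum_val v) | v < #|V|].
have [|p p0 pF] := mpoly_dependent F'; first by rewrite /M card_sig.
exists p => // theta thetaP; have := pF (fun i => theta (val (enum_val i))) => E.
rewrite -[RHS]E; apply: meval_eq => j; rewrite comp_mpoly_meval; apply: meval_eq => v.
rewrite tnth_mktuple /subst; case: insubP => [s _ sv|vP].
  by rewrite mevalXU enum_rankK sv.
by rewrite mevalC thetaP.
Qed.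

Section Chart.
Variables (K : fieldType) (k r : nat) (n : 'I_k -> nat) (o : 'I_k).
Variables (sigma : {dffun forall l, {ffun 'I_r -> 'I_(n l)}}).
Variables (e : {ffun 'I_k -> {ffun 'I_r -> 'I_r}}).
Local Notation X := {ffun 'I_k -> 'I_r}.

(** The block on which the maps [C l] of a chart restrict to the identity. *)
Definition minor (j : X) : tindex n := [ffun l => sigma l (j l)].

(** [C l] is the [l]-th map divided by its minor [sigma l], and [b l] the inverse of that
    minor, with column [a] rescaled to have entry 1 in row [e l a] when [l != o]. *)
Definition in_chart (T : tensor K n) :=
  exists (C : forall l, 'M[K]_(r, n l)) (b : 'I_k -> 'M[K]_r),
    [/\ forall l a x, x \in codom (sigma l) -> C l a x = (sigma l a == x)%:R,
        forall l a, l != o -> b l (e l a) a = 1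
      & forall j : X, \sum_(i : tindex n) (\prod_l C l (j l) (i l)) * T i =
                      \sum_a \prod_l b l (j l) a].

Hypothesis sigma_inj : forall l, injective (sigma l).

Lemma minor_inj : injective minor.
Proof.
move=> j j' /ffunP E; apply/ffunP => l; apply: (@sigma_inj l).
by have := E l; rewrite !ffunE.
Qed.

Lemma corner_of_chart (C : forall l, 'M[K]_(r, n l)) (T : tensor K n) (j : X) :
    (forall l a x, x \in codom (sigma l) -> C l a x = (sigma l a == x)%:R :> K) ->
  \sum_(i : tindex n) (\prod_l C l (j l) (i l)) * T i =
  T (minor j) + \sum_(i : tindex n | i \notin codom minor) (\prod_l C l (j l) (i l)) * T i.
Proof.
move=> CP; rewrite (bigID (mem (codom minor))) /=; congr (_ + _).
rewrite (bigD1 (minor j)) ?codom_f //= [X in _ + X]big1 => [|i /andP[/codomP[j' ->] ne]].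
  by rewrite addr0 big1 ?mul1r // => l _; rewrite ffunE CP ?codom_f ?eqxx.
have [l jl] : exists l, j l != j' l.
  apply/existsP; apply: contraNT ne => /existsPn E; apply/eqP; congr minor.
  by apply/ffunP => l; apply/eqP; rewrite eq_sym; move: (E l); rewrite negbK.
rewrite (bigD1 l) //= ffunE CP ?codom_f // (inj_eq (@sigma_inj l)) (negPf jl).
by rewrite !mul0r.
Qed.

Definition variable : finType :=
  ({l : 'I_k & ('I_r * 'I_(n l))%type} + ('I_k * ('I_r * 'I_r)) + tindex n)%type.

Definition varC l (a : 'I_r) (x : 'I_(n l)) : variable :=
  inl (inl (Tagged (fun l => ('I_r * 'I_(n l))%type) (a, x))).
Definition varb l a x : variable := inl (inr (l, (a, x))).
Definition varT i : variable := inr i.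

(** The entries of [C], [b] and [T] that [in_chart] leaves free; the entries of [T]
    in the block are functions of these. *)
Definition free_variable (v : variable) : bool :=
  match v with
  | inl (inl u) => (tagged u).2 \notin codom (sigma (tag u))
  | inl (inr (l, (a, x))) => (l == o) || (x != e l a)
  | inr i => i \notin codom minor
  end.

Lemma card_free_variable :
  (#|free_variable| + r ^ k =
     \sum_l r * (n l - r) + (r * r + k.-1 * (r * r.-1)) + #|{: tindex n}|)%N.
Proof.
have cC l : #|[predC codom (sigma l)]| = (n l - r)%N.
  have := cardC (mem (codom (sigma l))).
  rewrite (card_codom (@sigma_inj l)) !card_ord => E.
  by move: E; move: #|_| => c; lia.
have -> : #|free_variable| = (\sum_(v : variable | free_variable v) 1)%N.
  by rewrite sum1_card.
rewrite big_sumType /= big_sumType /= -addnA; congr (_ + _)%N; first congr (_ + _)%N.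
- rewrite -(sig_big_dep (fun=> true)
    (fun l (ax : 'I_r * 'I_(n l)) => ax.2 \notin codom (sigma l)) (fun _ _ => 1%N)) /=.
  apply: eq_bigr => l _.
  rewrite -(pair_big predT (fun x => x \notin codom (sigma l)) (fun _ _ => 1%N)) /=.
  by rewrite sum_nat_const card_ord sum1_card cC.
- transitivity (\sum_l \sum_a \sum_(x < r | (l == o) || (x != e l a)) 1)%N.
    under [RHS]eq_bigr do rewrite pair_big_dep.
    by rewrite [RHS]pair_big_dep; apply: eq_bigl => -[l [a x]].
  rewrite (bigD1 o) //= eqxx; congr (_ + _)%N.
    by under eq_bigr do rewrite sum1_card card_ord; rewrite sum_nat_const card_ord.
  rewrite (eq_bigr (fun=> r * r.-1)%N) => [|l /negPf lo].
    by rewrite sum_nat_const cardC1 card_ord.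
  rewrite lo /=; under eq_bigr do rewrite sum1_card cardC1 card_ord.
  by rewrite sum_nat_const card_ord.
- rewrite sum1_card -(cardC (mem (codom minor))) addnC; congr (_ + _)%N.
  by rewrite card_codom ?card_ffun ?card_ord //; apply: minor_inj.
Qed.

(** The equations of [in_chart] express the block of [T] as a polynomial in the
    free coordinates, of which there are fewer than entries of [T]. *)
Lemma chart_hypersurface : (0 < r)%N -> (forall l, r <= n l)%N ->
    (\sum_l n l < r ^ k.-1 + k.-1)%N ->
  exists2 p : tpoly K n, p != 0 & forall T, in_chart T -> tpoly_eval p T = 0.
Proof.
move=> r0 rn sum_n.
pose Y (v : variable) : {mpoly K[#|variable|]} := 'X_(enum_rank v).
pose kappa (v : variable) : K := match v with
  | inl (inl u) => (sigma (tag u) (tagged u).1 == (tagged u).2)%:R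
  | _ => 1 end.
pose F (i : tindex n) := if [pick j | minor j == i] is Some j then
    \sum_a \prod_l Y (varb l a (j l)) -
    \sum_(i' : tindex n | i' \notin codom minor) (\prod_l Y (varC (j l) (i' l))) * Y (varT i')
  else Y (varT i).
have [|p p0 pF] := @mpoly_dependent_const K _ _ free_variable kappa F.
  rewrite -(ltn_add2r (r ^ k)) card_free_variable addnC ltn_add2l.
  have kpos : (0 < k)%N by apply: leq_trans (ltn_ord o).
  rewrite -big_distrr /= sumnB // sum_nat_const card_ord.
  have -> : (r ^ k = r * r ^ k.-1)%N by rewrite -expnS prednK.
  rewrite mulnCA -!mulnDr ltn_mul2l r0 /=.
  have : (k * r <= \sum_l n l)%N.
    by rewrite -[k in (k * _)%N]card_ord -sum_nat_const leq_sum.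
  move: sum_n; move: (r ^ _)%N (\sum_(l < k) n l)%N => q s.
  by case: (k) kpos => // k' _ /=; case: (r) r0 => // r1 _ /=; rewrite mulSn !mulnS; lia.
exists p => // T [C [b [CP bP CT]]].
(* The block entries of T are frozen to the value 1 that kappa gives them. *)
pose theta (v : variable) : K := match v with
  | inl (inl u) => C (tag u) (tagged u).1 (tagged u).2
  | inl (inr (l, (a, x))) => b l x a
  | inr i => if i \in codom minor then 1 else T i end.
have Yt v : (Y v).@[fun v => theta (enum_val v)] = theta v by rewrite mevalXU enum_rankK.
have -> : tpoly_eval p T = p.@[fun j => (F (enum_val j)).@[fun v => theta (enum_val v)]].
  apply: meval_eq => i0; rewrite /F; case: pickP => [j /eqP ji|no]; last first.
    rewrite Yt /= ifN //; apply/codomP => -[j ij].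
    by have := no j; rewrite -ij eqxx.
  have := CT j; rewrite corner_of_chart // ji => /(canRL (addrK _)) ->.
  rewrite mevalB !(raddf_sum (meval _)) /=; congr (_ - _); apply: eq_bigr => i ic.
    by rewrite rmorph_prod; apply: eq_bigr => l _; rewrite [RHS]Yt.
  rewrite mevalM Yt rmorph_prod /= ifN //; congr (_ * _).
  by apply: eq_bigr => l _; rewrite [RHS]Yt.
apply: pF => -[[[l [a x]]|[l [a x]]]|i] //=.
- by rewrite negbK => /CP.
- by rewrite negb_or negbK => /andP[lo /eqP->]; apply: bP.
- by rewrite negbK => ->.
Qed.

End Chart.

Section Charts.
Variables (K : fieldType) (k r : nat) (n : 'I_k -> nat) (o : 'I_k).

(** The scales removed from the columns of [b l], [l != o], are gathered in [b o],
    since only products of columns with the same index matter. *)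
Lemma in_some_chart (T : tensor K n) : (1 < k)%N -> tensor_le (unit_tensor K k r) T ->
  exists (sigma : {dffun forall l, {ffun 'I_r -> 'I_(n l)}}) (e : {ffun 'I_k -> {ffun 'I_r -> 'I_r}}),
    (forall l, injective (sigma l)) /\ in_chart o sigma e T.
Proof.
move=> k1 [A AT].
have fullA l : row_full (A l)^T.
  have [B AB] := unit_tensor_le_factor k1 AT l.
  rewrite /row_full mxrank_tr eqn_leq rank_leq_row /=.
  by rewrite -[leqLHS](mxrank1 K r) -AB mxrankM_maxl.
pose sigma : {dffun forall l, {ffun 'I_r -> 'I_(n l)}} := [ffun l => fullrankfun (fullA l)].
have sigma_inj l : injective (sigma l) by rewrite ffunE; apply: fullrankfun_inj.
pose B l := colsub (sigma l) (A l).
have unitB l : B l \in unitmx.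
  rewrite -unitmx_tr (_ : (B l)^T = rowsub (sigma l) (A l)^T); last first.
    by apply/matrixP => i j; rewrite !mxE.
  by rewrite ffunE fullrowsub_unit.
pose C l := invmx (B l) *m A l; pose b l := invmx (B l).
have CP l a x : x \in codom (sigma l) -> C l a x = (sigma l a == x)%:R.
  case/codomP => c ->; have := mulVmx (unitB l) => /matrixP/(_ a c).
  rewrite !mxE (inj_eq (@sigma_inj l)) => <-; apply: eq_bigr => y _.
  by rewrite [B l y c]mxE.
have CT (j : {ffun 'I_k -> 'I_r}) :
    \sum_(i : tindex n) (\prod_l C l (j l) (i l)) * T i = \sum_a \prod_l b l (j l) a.
  pose j' : tindex (fun _ : 'I_k => r) := [ffun l => j l].
  have := tensor_map_comp b A T; rewrite AT => /ffunP/(_ j').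
  rewrite tensor_map_unit ffunE => E.
  transitivity (\sum_(i : tindex n) (\prod_l C l (j' l) (i l)) * T i).
    by apply: eq_bigr => i _; congr (_ * _); apply: eq_bigr => l _; rewrite ffunE.
  by rewrite -E; apply: eq_bigr => a _; apply: eq_bigr => l _; rewrite ffunE.
have bn0 l a : exists x, b l x a != 0.
  apply/existsP; apply: contraT => /existsPn b0.
  have := mulmxV (unitB l) => /matrixP/(_ a a); rewrite !mxE eqxx big1 => [/esym/eqP|x _].
    by rewrite oner_eq0.
  by have := b0 x; rewrite negbK => /eqP; rewrite /b => ->; rewrite mulr0.
have /fin_all_exists[e0 e0P] : forall l, exists e : {ffun 'I_r -> 'I_r}, forall a, b l (e a) a != 0.
  move=> l; have /fin_all_exists[f fP] := bn0 l.
  by exists [ffun a => f a] => a; rewrite ffunE.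
pose e : {ffun 'I_k -> {ffun 'I_r -> 'I_r}} := [ffun l => e0 l].
have eP l a : b l (e l a) a != 0 by rewrite ffunE.
pose b' l : 'M[K]_r := \matrix_(x, a) (b l x a *
  if l == o then \prod_(l' | l' != o) b l' (e l' a) a else (b l (e l a) a)^-1).
exists sigma, e; split=> //; exists C, b'; split=> [//|l a lo|j].
  by rewrite mxE (negPf lo) mulfV.
rewrite CT; apply: eq_bigr => a _; under [RHS]eq_bigr do rewrite mxE.
rewrite big_split /= [X in _ * X](bigD1 o) //= eqxx -big_split /=.
by rewrite [X in _ * X]big1 ?mulr1 // => l /negPf lo; rewrite lo mulfV.
Qed.

Lemma unit_le_hypersurface : (1 < k)%N -> (0 < r)%N -> (forall l, r <= n l)%N ->
    (\sum_l n l < r ^ k.-1 + k.-1)%N ->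
  exists2 p : tpoly K n, p != 0 &
    forall T, tensor_le (unit_tensor K k r) T -> tpoly_eval p T = 0.
Proof.
move=> k1 r0 rn sum_n.
pose chart := ({dffun forall l, {ffun 'I_r -> 'I_(n l)}} * {ffun 'I_k -> {ffun 'I_r -> 'I_r}})%type.
have /fin_all_exists2[p p0 pP] : forall c : chart, exists2 p : tpoly K n, p != 0 &
    (forall l, injective (c.1 l)) -> forall T, in_chart o c.1 c.2 T -> tpoly_eval p T = 0.
  move=> [sigma e]; have [inj|ninj] := boolP [forall l, injectiveb (sigma l)].
    have sigma_inj l : injective (sigma l) by apply/injectiveP; apply: (forallP inj).
    by have [p p0 pP] := chart_hypersurface K o e sigma_inj r0 rn sum_n; exists p.
  exists 1 => [|inj]; first exact: oner_neq0.
  by case/negP: ninj; apply/forallP => l; apply/injectiveP; apply: inj.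
exists (\prod_c p c); first by apply/prodf_neq0.
move=> T /(in_some_chart k1)[sigma [e [inj chartT]]].
rewrite /tpoly_eval rmorph_prod (bigD1 (sigma, e)) //=.
by have := pP (sigma, e) inj T chartT; rewrite /tpoly_eval => ->; rewrite mul0r.
Qed.

End Charts.

(** * The generic subrank *)

Lemma zariski_denseP (K : fieldType) k (n : 'I_k -> nat) (C : tensor K n -> Prop) :
  zariski_dense C <-> forall p : tpoly K n,
    (forall T, C T -> tpoly_eval p T = 0) -> forall T, tpoly_eval p T = 0.
Proof.
split=> [denseC p pC|denseC Z [S ZS] CZ T].
  apply: (denseC (fun T => tpoly_eval p T = 0)) => //.
  by exists (eq p) => T; split=> [pT _ <-|]; last exact.
by apply/ZS => p Sp; apply: denseC => T' /CZ/ZS; apply.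
Qed.

Lemma leq_sum_pos k (n : 'I_k -> nat) : (forall l, 0 < n l)%N -> (k <= \sum_l n l)%N.
Proof.
move=> n0; apply: leq_trans (_ : \sum_(l < k) 1 <= _)%N; last exact: leq_sum.
by rewrite sum_nat_const card_ord muln1.
Qed.

(** For cubic shapes, this makes [r <= n] a consequence of the other bound. *)
Lemma lt_line_exp d n : (1 < d)%N -> (d.+1 * n < n.+1 ^ d + d)%N.
Proof.
case: d => [|[|d]] // _; elim: d => [|d IH]; first by rewrite expnS expn1; nia.
have : (0 < n.+1 ^ d.+2)%N by rewrite expn_gt0.
by move: IH; rewrite [in X in _ -> _ -> X]expnS mulSn; move: (n.+1 ^ d.+2)%N => e; nia.
Qed.

Lemma dense_subrank_geP (K : fieldType) k (n : 'I_k -> nat) r :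
    infinite_type K -> (3 <= k)%N -> (forall l, 0 < n l)%N ->
  zariski_dense (@subrank_ge K k n r) <->
    (forall l, r <= n l)%N /\ (r ^ k.-1 + k.-1 <= \sum_l n l)%N.
Proof.
move=> infK k3 n0; have k1 : (1 < k)%N by apply: leq_trans k3.
have evalT (p : tpoly K n) : p != 0 -> exists T, tpoly_eval p T != 0.
  move=> /(mpoly_nonzero_value infK)[v pv]; exists [ffun i => v (enum_rank i)].
  suff -> : tpoly_eval p [ffun i => v (enum_rank i)] = p.@[v] by [].
  by apply: meval_eq => i; rewrite ffunE enum_valK.
split=> [/zariski_denseP dense|[rn sum_n]]; last first.
  apply/zariski_denseP => p pC; apply: (unit_le_dense infK k3 rn sum_n) => S.
  by move/(subrank_geE _ _ k1); apply: pC.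
have rn l : (r <= n l)%N.
  rewrite leqNgt; apply/negP => nr.
  have [T] := evalT 1 (oner_neq0 _); rewrite dense ?eqxx // => S /(subrank_geE _ _ k1).
  by move/(subrank_bound k1)/(_ l); rewrite leqNgt nr.
split=> //; rewrite leqNgt; apply/negP => sum_n.
have [r0|r0] := posnP r.
  move: sum_n; rewrite r0 exp0n; last by case: (k) k1 => [|[]].
  by have := leq_sum_pos n0; lia.
have [p /evalT[T]] := unit_le_hypersurface K (Ordinal (ltnW k1)) k1 r0 rn sum_n.
by move=> + pC; rewrite dense ?eqxx // => S /(subrank_geE _ _ k1)/pC.
Qed.

Lemma leq_floor_root d r m : (0 < d)%N -> (r <= floor_root d m%:R)%N = (r ^ d <= m)%N.
Proof.
move=> d0; rewrite /floor_root truncn_ge_nat ?rootC_ge0 ?ler0n //.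
rewrite -[in LHS](rootCK d0 r%:R) -rootCpX ?ler0n // ler_rootC ?qualifE /= ?exprn_ge0 ?ler0n //.
by rewrite -natrX ler_nat.
Qed.

Lemma leq_bigminn (I : finType) (F : I -> nat) x m :
  (m <= \big[minn/x]_i F i)%N = (m <= x)%N && [forall i, m <= F i]%N.
Proof.
apply/idP/andP => [le|[mx /forallP mF]].
  split.
    apply: leq_trans le _; elim: (index_enum I) => [|i s IH]; rewrite ?big_nil ?big_cons //.
    by apply: leq_trans (geq_minr _ _) IH.
  apply/forallP => i; apply: leq_trans le _; have := mem_index_enum i.
  elim: (index_enum I) => // j s IH; rewrite inE big_cons => /predU1P[->|/IH].
    exact: geq_minl.
  by apply: leq_trans (geq_minr _ _).
by apply: (big_ind (fun y => m <= y)%N) => // a b; rewrite leq_min => -> ->.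
Qed.

Theorem theorem3p7 (K : fieldType) (k : nat)
    (infK : infinite_type K) (k_ge3 : (3 <= k)%N) :
  (forall n : 'I_k -> nat, (forall l, (0 < n l)%N) ->
     is_generic_subrank K n
       (\big[minn/floor_root k.-1
                    ((\sum_(l < k) n l)%N%:R - (k.-1)%:R)%R]_(l < k) n l))
  /\
  (forall n : nat, (0 < n)%N ->
     is_generic_subrank K (fun _ : 'I_k => n)
       (floor_root k.-1 ((k * n)%N%:R - k%:R + 1)%R)).
Proof.
have k1 : (0 < k.-1)%N by case: (k) k_ge3 => [|[]].
have generic (n : 'I_k -> nat) q : (forall l, 0 < n l)%N ->
    (forall r, (r <= q)%N = [forall l, r <= n l]%N && (r ^ k.-1 + k.-1 <= \sum_l n l)%N) ->
    is_generic_subrank K n q.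
  move=> n0 qP; have denseP r : zariski_dense (@subrank_ge K k n r) <-> (r <= q)%N.
    rewrite qP; split=> [/(dense_subrank_geP _ infK k_ge3 n0)[rn ->]|].
      by rewrite andbT; apply/forallP.
    by case/andP=> /forallP rn sum_n; apply/(dense_subrank_geP _ infK k_ge3 n0).
  by split=> [|r /denseP//]; apply/denseP.
split=> n n0.
  have km : (k.-1 <= \sum_l n l)%N by apply: leq_trans (leq_pred k) (leq_sum_pos n0).
  apply: generic => // r; rewrite leq_bigminn andbC -natrB // (leq_floor_root _ _ k1).
  by rewrite -(leq_add2r k.-1) subnK.
apply: generic => // r.
rewrite sum_nat_const card_ord.
have -> : ((k * n)%N%:R - k%:R + 1 = (k * n - k.-1)%N%:R :> algC).
  rewrite natrB; last by apply: leq_trans (leq_pred k) _; rewrite leq_pmulr.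
  by rewrite -[in k%:R](prednK (ltnW (ltnW k_ge3))) -natr1; ring.
rewrite (leq_floor_root _ _ k1) -(leq_add2r k.-1) subnK; last first.
  by apply: leq_trans (leq_pred k) _; rewrite leq_pmulr.
rewrite andb_idl // => le; apply/forallP => _; rewrite leqNgt; apply/negP => nr.
have nrX : (n.+1 ^ k.-1 <= r ^ k.-1)%N by rewrite leq_exp2r.
have d1 : (1 < k.-1)%N by case: (k) k_ge3 => [|[|[]]].
have := lt_line_exp n d1; rewrite prednK; last by apply: leq_trans k_ge3.
by rewrite ltnNge (leq_trans _ le) // leq_add2r.
Qed.
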